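(* Let $p$ be an odd prime. (a) If $G$ is a finite UCS group of exponent $p^2$, then $\mathcal G(\mathcal L(G))\cong G$. (b) If $L$ is a finite-dimensional IAC algebra over $\mathbb F_p$, then $\mathcal L(\mathcal G(L))\cong L$. Therefore the induced maps $\mathcal G\colon \mathrm{IAC}_p\to\mathrm{UCS}_{p^2}$ and $\mathcal L\colon\mathrm{UCS}_{p^2}\to\mathrm{IAC}_p$ on isomorphism classes are bijections.
   Context: A group is UCS if it has a unique non-trivial proper characteristic subgroup. $\mathrm{UCS}_{p^2}$ is the set of isomorphism classes of finite UCS $p$-groups of exponent $p^2$. An anti-commutative algebra over a field is a (not necessarily associative) algebra, with product written $\llbracket x,y\rrbracket$, satisfying $\llbracket x,x\rrbracket=0$ for all $x$. It is IAC if in addition its automorphism group acts irreducibly on the vector space $L$, and abelian if all products are zero. $\mathrm{IAC}_p$ is the set of isomorphism classes of finite-dimensional IAC algebras over $\mathbb F_p$. Definition of $\mathcal L(G)$: let $G$ be a finite UCS $p$-group of exponent $p^2$ ($p$ odd), $\overline G=G/\Phi(G)$ (an $\mathbb F_p$-vector space), $\overline g=g\Phi(G)$. It is known that $\overline g\mapsto g^p$ is a well-defined isomorphism $\overline G\to\Phi(G)$; for $h\in\Phi(G)$, let $h^{1/p}\in\overline G$ be its unique preimage. Then $\mathcal L(G)$ is $\overline G$ with product $\llbracket\overline x,\overline y\rrbracket=[x,y]^{1/p}$, where $[x,y]=x^{-1}y^{-1}xy$. Definition of $\mathcal G(L)$: let $L$ be an IAC algebra over $\mathbb F_p$ with basis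 $v_1,\dots,v_r$ and $\llbracket v_i,v_j\rrbracket=\sum_{k=1}^r c_k^{(i,j)}v_k$ for $1\le i<j\le r$, the $c_k^{(i,j)}$ being also regarded as integers in $\{0,\dots,p-1\}$. If $L$ is abelian, $\mathcal G(L)=(C_{p^2})^r$. If $L$ is non-abelian, let $H$ be the relatively free group on $r$ generators $h_1,\dots,h_r$ in the variety of groups of exponent dividing $p^2$ and nilpotency class at most $2$ in which all $p$-th powers are central, let $N=\langle [h_i,h_j]^{-1}\prod_{k=1}^r (h_k^p)^{c_k^{(i,j)}} : 1\le i<j\le r\rangle$ (a central subgroup of $H$), and put $\mathcal G(L)=H/N$. Each of $\mathcal L,\mathcal G$ is considered up to isomorphism. *)

(* Defs.v *)
From HB Require Import structures.
From mathcomp Require Import all_boot all_order all_algebra all_fingroup.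
From mathcomp Require Import all_solvable all_character.
From mathcomp Require Import boolp.

Set Implicit Arguments.
Unset Strict Implicit.
Unset Printing Implicit Defensive.

Import GRing.Theory GroupScope.
Local Open Scope group_scope.

(* Not set_bij: classical_sets' type of sets over finGroupType is rejected by
   the universe constraints. *)
Definition bijective_between (T U : Type) (A : T -> Prop) (B : U -> Prop)
    (f : T -> U) : Prop :=
  [/\ forall x, A x -> B (f x),
      forall x y, A x -> A y -> f x = f y -> x = y
    & forall y, B y -> exists2 x, A x & f x = y].

Section Groups.

Definition is_ucs (gT : finGroupType) (G : {group gT}) : bool :=
  #|[set H : {group gT} | [&& H \char G, H :!=: 1 & H \proper G]]| == 1%N.

Definition is_ucs_p2 (p : nat) (gT : finGroupType) (G : {group gT}) : bool :=
  is_ucs G && (exponent G == p ^ 2)%N.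

Definition group_class (gT : finGroupType) : finGroupType -> Prop :=
  fun hT => [set: hT] \isog [set: gT].

Definition UCS_p2 (p : nat) : (finGroupType -> Prop) -> Prop :=
  fun C => exists2 gT : finGroupType,
    is_ucs_p2 p [set: gT]%G & C = group_class gT.

End Groups.

Section Algebras.

(* An algebra is a finite-dimensional space with a product; bilinearity is part
   of is_anticommutative. *)
Record algebra (F : fieldType) := Algebra {
  alg_space :> vectType F;
  alg_mul : alg_space -> alg_space -> alg_space
}.

Variable F : fieldType.
Implicit Types L M : algebra F.

Definition is_anticommutative L : Prop :=
  [/\ forall x : L, linear (@alg_mul F L x),
      forall y : L, linear (fun x : L => alg_mul x y)
    & forall x : L, alg_mul x x = 0%R].

Definition is_alg_iso L M (f : 'Hom(L, M)) : Prop :=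
  bijective f /\ forall x y : L, f (alg_mul x y) = alg_mul (f x) (f y).

Definition alg_isomorphic L M : Prop :=
  exists f : 'Hom(L, M), is_alg_iso f.

Definition aut_irreducible L : Prop :=
  (fullv : {vspace L}) <> 0%VS /\
  forall U : {vspace L},
    (forall f : 'Hom(L, L), is_alg_iso f -> (f @: U <= U)%VS) ->
    U = 0%VS \/ U = fullv.

Definition is_IAC L : Prop := is_anticommutative L /\ aut_irreducible L.

Definition is_abelian_alg L : Prop := forall x y : L, alg_mul x y = 0%R.

Definition alg_class L : algebra F -> Prop :=
  fun M => alg_isomorphic M L.

End Algebras.

Definition IAC_p (p : nat) : (algebra 'F_p -> Prop) -> Prop :=
  fun C => exists2 L : algebra 'F_p, is_IAC L & C = alg_class L.
Arguments IAC_p p C : clear implicits.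

Section FromGroups.

Lemma ucs_p2_pgroup p (gT : finGroupType) (G : {group gT}) :
  prime p -> is_ucs_p2 p G -> p.-group G.
Proof.
move=> p_pr /andP[_ /eqP eG].
by rewrite -pnat_exponent eG pnatX pnat_id.
Qed.

Lemma ucs_p2_abelem p (gT : finGroupType) (G : {group gT}) :
  prime p -> is_ucs_p2 p G -> p.-abelem (G / 'Phi(G)).
Proof. by move=> p_pr ucsG; apply/Phi_quotient_abelem/ucs_p2_pgroup. Qed.

Lemma ucs_p2_neq1 p (gT : finGroupType) (G : {group gT}) :
  is_ucs_p2 p G -> G / 'Phi(G) != 1.
Proof.
case/andP=> /cards1P[H defH] _.
have: H \in [set H] by rewrite inE.
rewrite -defH inE => /and3P[_ _ /proper_card ltHG].
have ntG : G :!=: 1.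
  by rewrite -cardG_gt1; apply: leq_ltn_trans ltHG; apply: cardG_gt0.
by rewrite -cardG_gt1 card_quotient ?gFnorm // indexg_gt1; case/andP: (Phi_proper ntG).
Qed.

(* h^(1/p): the coset u of the elements g of G with g^p = h. *)
Definition pth_root p (gT : finGroupType) (G : {group gT}) (h : gT) :
    coset_of 'Phi(G) :=
  odflt 1 [pick u in G / 'Phi(G) |
             [exists g in G, (coset 'Phi(G) g == u) && (g ^+ p == h)]].

Variables (p : nat) (p_pr : prime p) (gT : finGroupType) (G : {group gT}).
Hypothesis ucsG : is_ucs_p2 p G.

(* abelem_rV and rVabelem are inverse isomorphisms between G / 'Phi(G) and the
   additive group of the F_p-space 'rV(G / 'Phi(G)). *)
Let abG := ucs_p2_abelem p_pr ucsG.
Let ntG := ucs_p2_neq1 ucsG.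

Definition calL : algebra 'F_p :=
  @Algebra 'F_p 'rV['F_p]_('dim (G / 'Phi(G)))
    (fun u v => abelem_rV abG ntG
       (pth_root p G [~ repr (rVabelem abG ntG u), repr (rVabelem abG ntG v)])).

End FromGroups.

Definition in_variety (p : nat) (K : groupType) : Prop :=
  [/\ forall x : K, x ^+ (p ^ 2)%N = 1,
      forall x y z : K, [~ [~ x, y], z] = 1
    & forall x y : K, commute (x ^+ p) y].

(* The relatively free groups of rank r; they exist as finite groups
   (relfree_model), hence are all finite; K ranges over all groups. *)
Record relfree (p r : nat) := Relfree {
  rf_group :> finGroupType;
  rf_gen : 'I_r -> rf_group;
  rf_variety : in_variety p rf_group;
  rf_universal : forall (K : groupType) (k : 'I_r -> K), in_variety p K ->
    exists f : rf_group -> K,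
      [/\ {morph f : x y / x * y}, forall i, f (rf_gen i) = k i
        & forall g : rf_group -> K, {morph g : x y / x * y} ->
            (forall i, g (rf_gen i) = k i) -> g =1 f]
}.

Section Collect.
Variables (p : nat) (K : groupType).
Hypothesis varK : in_variety p K.

Lemma expg_modp2 (x : K) n : x ^+ (n %% p ^ 2) = x ^+ n.
Proof.
have [e _ _] := varK.
by rewrite {2}(divn_eq n (p ^ 2)) expgnDr mulnC expgnA e expg1n mul1g.
Qed.

Lemma comm_central (x y z : K) : commute z [~ x, y].
Proof. by apply/commute_sym/commgP; have [_ -> _] := varK. Qed.

Lemma commg_mulr (x y z : K) : [~ x, y * z] = [~ x, y] * [~ x, z].
Proof.
apply: (mulgI (y * z * x)).
rewrite -commgC; move: (commgC x y) (commgC x z) (comm_central x y).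
move: [~ x, y] [~ x, z] => c d xy xz cC.
by rewrite -(cC d) !mulgA -(mulgA y z) -(mulgA y) -xz -!mulgA cC !mulgA xy.
Qed.

Lemma commg_mull (x y z : K) : [~ x * y, z] = [~ x, z] * [~ y, z].
Proof.
apply: (mulgI (z * (x * y))); rewrite -commgC.
move: (commgC x z) (commgC y z) (comm_central x z).
move: [~ x, z] [~ y, z] => c d xz yz cC.
by rewrite !mulgA -(mulgA _ y) cC !mulgA -xz -!mulgA yz !mulgA.
Qed.

Lemma commgXl (x z : K) m : [~ x ^+ m, z] = [~ x, z] ^+ m.
Proof. by elim: m => [|m IHm]; rewrite ?comm1g // !expgS commg_mull IHm. Qed.

Lemma commgXr (x z : K) m : [~ x, z ^+ m] = [~ x, z] ^+ m.
Proof. by elim: m => [|m IHm]; rewrite ?commg1 // !expgS commg_mulr IHm. Qed.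

Lemma commg_modp (x y : K) n : [~ x, y] ^+ (n %% p) = [~ x, y] ^+ n.
Proof.
rewrite {2}(divn_eq n p) expgnDr mulnC expgnA -(commgXl x y p).
have [_ _ c] := varK; have /commgP/eqP -> := c x y.
by rewrite expg1n mul1g.
Qed.

Definition pows r (k : 'I_r -> K) (a : 'I_r -> nat) := \prod_(i < r) k i ^+ a i.

Definition comms r (k : 'I_r -> K) (c : 'I_r -> 'I_r -> nat) :=
  \prod_(i < r) \prod_(j < r | j < i) [~ k i, k j] ^+ c i j.

Lemma comms_central r (k : 'I_r -> K) c z : commute z (comms k c).
Proof.
apply: commute_prod => i _; apply: commute_prod => j _.
exact/commuteX/comm_central.
Qed.

Lemma commsD r (k : 'I_r -> K) c d :
  comms k (fun i j => c i j + d i j)%N = comms k c * comms k d.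
Proof.
rewrite /comms -prodgM_commute => [|i i' _ _]; last first.
  apply: commute_prod => j _; exact/commuteX/comm_central.
apply: eq_bigr => i _; rewrite -prodgM_commute => [|j j' _ _]; last first.
  exact/commuteX/comm_central.
by apply: eq_bigr => j _; rewrite expgnDr.
Qed.

Lemma powsM r (k : 'I_r -> K) a b :
  pows k a * pows k b
    = pows k (fun i => a i + b i)%N * comms k (fun i j => a i * b j)%N.
Proof.
rewrite /pows /comms; elim: r k a b => [|r IHr] k a b.
  by rewrite !big_ord0 mulg1.
pose w : 'I_r -> 'I_r.+1 := widen_ord (leqnSn r); pose m : 'I_r.+1 := ord_max.
rewrite ![X in X * _ = _]big_ord_recr ![X in _ * X = _]big_ord_recr.
rewrite ![in RHS]big_ord_recr /= -/w -/m.
have AB := IHr (k \o w) (a \o w) (b \o w).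
pose D := comms (k \o w) (fun i j => a (w i) * b (w j))%N.
rewrite -[X in _ = _ * X]/(D) /= in AB.
set A := \prod_(i < r) k (w i) ^+ a (w i) in AB *.
set B := \prod_(i < r) k (w i) ^+ b (w i) in AB *.
have -> : \prod_(i < r) \prod_(j < r.+1 | j < i) [~ k (w i), k j] ^+ (a (w i) * b j)
    = D.
  apply: eq_bigr => i _; rewrite big_mkcond big_ord_recr /= -/w -/m.
  by rewrite ltnNge (ltnW (ltn_ord i)) mulg1 -big_mkcond.
have -> : \prod_(j < r.+1 | j < r) [~ k m, k j] ^+ (a m * b j)
    = [~ k m ^+ a m, B].
  rewrite big_mkcond big_ord_recr /= ltnn mulg1 /B.
  apply: (big_ind2 (fun x y => x = [~ k m ^+ a m, y])) => [|x x' y y' -> ->|i _].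
  - by rewrite commg1.
  - by rewrite commg_mulr.
  by rewrite ltn_ord [RHS]commgXl [X in _ = X ^+ _]commgXr expgnA expgnAC.
have cD z : commute z D by exact: comms_central.
have := commgC (k m ^+ a m) B.
have := comm_central (k m ^+ a m) B.
move: [~ k m ^+ a m, B] => e ce xB.
rewrite expgnDr -!mulgA (mulgA _ B) xB -!mulgA -(ce (k m ^+ b m)) (mulgA A) AB.
rewrite -!mulgA; congr (_ * _).
by rewrite [RHS]mulgA [RHS]mulgA (cD (k m ^+ a m * k m ^+ b m)) -!mulgA.
Qed.

End Collect.

(* A relatively free group: the subgroup generated by the (e_i, 0) in the
   central extension of (Z/p^2)^r by the r x r matrices over F_p with cocycle
   (a, b) |-> a^T b. *)
Section Model.
Variables p r : nat.
Hypothesis p_pr : prime p.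

Let p2_gt1 : 1 < p ^ 2.
Proof. by rewrite -(expn0 p) ltn_exp2l // prime_gt1. Qed.

Definition red (x : 'Z_(p ^ 2)) : 'F_p := (x : nat)%:R%R.

Lemma natFp n : ((n%:R%R : 'F_p) : nat) = n %% p.
Proof. exact: val_Fp_nat. Qed.

Lemma ZpD (x y : 'Z_(p ^ 2)) : ((x + y)%R : nat) = (x + y)%N %% p ^ 2.
Proof.
by rewrite -{1}[x]natr_Zp -{1}[y]natr_Zp -natrD (val_Zp_nat p2_gt1).
Qed.

Lemma red_natr n : red n%:R%R = n%:R%R.
Proof.
apply: val_inj; rewrite /red [LHS]natFp [RHS]natFp (val_Zp_nat p2_gt1).
by rewrite modn_dvdm // dvdn_exp.
Qed.

Lemma red_is_additive : {morph red : x y / (x + y)%R}.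
Proof. by move=> x y; rewrite -{1}[x]natr_Zp -{1}[y]natr_Zp -natrD red_natr natrD. Qed.

Definition model : Type := ('rV['Z_(p ^ 2)]_r * 'M['F_p]_r)%type.
HB.instance Definition _ := Finite.on model.

Definition redv (a : 'rV['Z_(p ^ 2)]_r) : 'rV['F_p]_r := map_mx red a.
Definition cocyc (a b : 'rV['Z_(p ^ 2)]_r) : 'M['F_p]_r :=
  ((redv a)^T *m redv b)%R.

Lemma redvD : {morph redv : a b / (a + b)%R}.
Proof. by move=> a b; apply/rowP=> i; rewrite !mxE red_is_additive. Qed.
Lemma cocycDl a b c : cocyc (a + b) c = (cocyc a c + cocyc b c)%R.
Proof. by rewrite /cocyc redvD linearD mulmxDl. Qed.
Lemma cocycDr a b c : cocyc a (b + c) = (cocyc a b + cocyc a c)%R.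
Proof. by rewrite /cocyc redvD mulmxDr. Qed.

Definition model_mul (x y : model) : model :=
  (x.1 + y.1, x.2 + y.2 + cocyc x.1 y.1)%R.
Definition model_one : model := (0, 0)%R.
Definition model_inv (x : model) : model := (- x.1, - x.2 + cocyc x.1 x.1)%R.

Lemma redv0 : redv 0 = 0%R.
Proof. by apply: (addrI (redv 0)); rewrite -redvD !addr0. Qed.

Lemma model_mulA : associative model_mul.
Proof.
move=> x y z; congr (_, _); first exact: addrA.
rewrite /= cocycDl cocycDr -!addrA; do 2!congr (_ + _)%R.
by rewrite [RHS]addrCA; congr (_ + _)%R; rewrite addrC -addrA.
Qed.

Lemma model_mul1 : left_id model_one model_mul.
Proof.
by case=> a c; congr (_, _); rewrite /= !add0r // /cocyc redv0 trmx0 mul0mx addr0.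
Qed.

Lemma model_mulV : left_inverse model_one model_inv model_mul.
Proof.
case=> a c; congr (_, _); rewrite /= ?addNr // addrAC addrC -addrA -cocycDl.
by rewrite addrC subrr /cocyc redv0 trmx0 mul0mx addr0 addNr.
Qed.

HB.instance Definition _ :=
  Finite_isGroup.Build model model_mulA model_mul1 model_mulV.

Lemma model_mulE (x y : model) :
  x * y = (x.1 + y.1, x.2 + y.2 + cocyc x.1 y.1)%R :> model.
Proof. by []. Qed.
Lemma model_oneE : 1 = (0, 0)%R :> model. Proof. by []. Qed.

Lemma model_exp1 (x : model) n : (x ^+ n).1 = (x.1 *+ n)%R.
Proof. by elim: n => // n IHn; rewrite expgS mulrS -IHn. Qed.

Lemma model_exp2 (x : model) n : redv x.1 = 0%R -> (x ^+ n).2 = (x.2 *+ n)%R.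
Proof.
move=> x0; elim: n => // n IHn; rewrite expgS mulrS -IHn /=.
by rewrite /cocyc x0 trmx0 mul0mx addr0.
Qed.

Lemma model_central (x y : model) : redv x.1 = 0%R -> commute x y.
Proof.
move=> x0; rewrite /commute !model_mulE /cocyc x0 trmx0 mul0mx mulmx0 !addr0.
by congr (_, _); apply: addrC.
Qed.

Lemma redv_pmul a : redv (a *+ p) = 0%R.
Proof.
have redvMn n : redv (a *+ n) = (redv a *+ n)%R.
  by elim: n => [|n IHn]; rewrite ?redv0 // !mulrS redvD IHn.
by apply/rowP=> i; rewrite redvMn -scaler_nat pchar_Fp_0 ?scale0r // mxE.
Qed.

Lemma model_variety : in_variety p model.
Proof.
split=> [x|x y z|x y].
- have x0 : redv (x ^+ p).1 = 0%R by rewrite model_exp1 redv_pmul.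
  rewrite expnSr expn1 expgnA model_oneE [LHS]surjective_pairing.
  rewrite model_exp2 // 2!model_exp1 -mulrnA -!scaler_nat pchar_Fp_0 // scale0r.
  by rewrite mulnn pchar_Zp // scale0r.
- apply/eqP/commgP/model_central.
  suff -> : [~ x, y].1 = 0%R by apply: redv0.
  rewrite /commg /conjg !model_mulE /=.
  by rewrite [(x.1 + y.1)%R]addrC addKr addNr.
by apply: model_central; rewrite model_exp1 redv_pmul.
Qed.

Definition model_gen (i : 'I_r) : model := (delta_mx 0 i, 0)%R.

Definition model_grp : {group model} := <<[set model_gen i | i : 'I_r]>>%G.

Definition model_sgen (i : 'I_r) : subg_of model_grp :=
  subg model_grp (model_gen i).

Lemma model_sgenE i : sgval (model_sgen i) = model_gen i.
Proof. by rewrite subgK // mem_gen // imset_f. Qed.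

Lemma model_sub_variety : in_variety p (subg_of model_grp).
Proof.
have sgX (x : subg_of model_grp) n : sgval (x ^+ n) = sgval x ^+ n.
  by elim: n => // n IHn; rewrite !expgS -IHn.
have [e c z] := model_variety.
split=> [x|x y t|x y]; apply: val_inj => /=.
- by rewrite sgX e.
- exact: c (sgval x) (sgval y) (sgval t).
by rewrite sgX; apply: z.
Qed.

Section Univ.
Variables (K : groupType) (k : 'I_r -> K).
Hypothesis varK : in_variety p K.

Definition model_mor (x : model) : K :=
  pows k (fun i => x.1 0%R i) * comms k (fun i j => x.2 i j).

Lemma model_morM : {morph model_mor : x y / x * y}.
Proof.
move=> x y; rewrite /model_mor !mulgA -(mulgA (pows _ _)) -(comms_central varK).
rewrite !mulgA (powsM varK) -!mulgA; congr (_ * _).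
  apply: eq_bigr => i _; rewrite model_mulE mxE ZpD; exact: expg_modp2.
rewrite -!(commsD varK); apply: eq_bigr => i _; apply: eq_bigr => j _.
rewrite -(commg_modp varK) -[RHS](commg_modp varK); congr (_ ^+ _).
rewrite model_mulE !mxE big_ord1 !mxE.
rewrite -[in RHS]natFp -[in LHS]natFp !natrD natrM.
by rewrite natr_Zp addrC !natr_Zp.
Qed.

Lemma model_mor_gen i : model_mor (model_gen i) = k i.
Proof.
rewrite /model_mor /pows /comms /= [X in _ * X]big1 => [|j _]; last first.
  by apply: big1 => l _; rewrite mxE.
rewrite mulg1.
have <- : \prod_(j < r | j == i) k j = k i by exact: big_pred1_eq.
rewrite [RHS]big_mkcond; apply: eq_bigr => j _.
by rewrite mxE eqxx /=; case: eqP.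
Qed.

End Univ.

Lemma relfree_model : relfree p r.
Proof.
exists (subg_of model_grp) model_sgen; first exact: model_sub_variety.
move=> K k varK; have fM := model_morM k varK.
exists (model_mor k \o sgval); split=> [x y|i|g gM gk x] /=.
- exact: fM.
- by rewrite model_sgenE model_mor_gen.
pose f := model_mor k.
have f1 : f 1 = 1 by apply: (mulgI (f 1)); rewrite -fM !mulg1.
have g1 : g 1 = 1 by apply: (mulgI (g 1)); rewrite -gM !mulg1.
pose S := model_grp :&: [set y | g (subg model_grp y) == f y].
have gS : group_set S.
  apply/group_setP; split=> [|y z].
    by rewrite !inE group1 (morph1 (subg_morphism _)) f1 g1 eqxx.
  rewrite !inE => /andP[Gy /eqP gy] /andP[Gz /eqP gz].
  by rewrite groupM //= subgM // gM gy gz -[f (y * z)]/(model_mor k (y * z)) fM.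
have: model_grp \subset Group gS.
  rewrite gen_subG; apply/subsetP=> _ /imsetP[i _ ->].
  by rewrite !inE mem_gen ?imset_f //= gk /f model_mor_gen.
by move/subsetP/(_ _ (valP x)); rewrite !inE => /andP[_ /eqP]; rewrite sgvalK.
Qed.
End Model.

Section FromAlgebras.

Variables (p r : nat) (L : algebra 'F_p) (v : r.-tuple L) (H : relfree p r).

Definition struct_coef (i j k : 'I_r) : nat :=
  coord v k (alg_mul (tnth v i) (tnth v j)).

Definition calG_rel (i j : 'I_r) : H :=
  [~ rf_gen H i, rf_gen H j]^-1
    * \prod_(k < r) (rf_gen H k ^+ p) ^+ struct_coef i j k.

Definition calG_ker : {group H} :=
  <<[set calG_rel ij.1 ij.2 | ij : 'I_r * 'I_r & ij.1 < ij.2]>>%G.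

(* coset_of N is the type of cosets of N in its normaliser; calG_ker being
   central, it is all of H / calG_ker. *)
Definition calG : finGroupType :=
  if `[< is_abelian_alg L >] then {dffun forall i : 'I_r, 'Z_(p ^ 2)} : finGroupType
  else coset_of calG_ker.

End FromAlgebras.

Section Classes.

Variable p : nat.

(* All choices of a representative of the class, of a basis and of a relatively
   free group are allowed; the choice does not matter exactly when the image of
   a class in IAC_p p is again a single isomorphism class. *)
Definition calG_class (C : algebra 'F_p -> Prop) : finGroupType -> Prop :=
  fun K => exists (L : algebra 'F_p) (r : nat) (v : r.-tuple L)
                  (H : relfree p r),
      [/\ C L, basis_of {:L} v & [set: K] \isog [set: calG v H]].

Definition calL_class (p_pr : prime p) (C : finGroupType -> Prop) :
    algebra 'F_p -> Prop :=
  fun M => exists (gT : finGroupType) (ucsG : is_ucs_p2 p [set: gT]%G),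
      C gT /\ alg_isomorphic M (calL p_pr ucsG).

End Classes.

(* Main.v *)
Require Import Defs.
From HB Require Import structures.
From mathcomp Require Import all_boot all_order all_algebra all_fingroup.
From mathcomp Require Import all_solvable all_character.
From mathcomp Require Import boolp.

Set Implicit Arguments.
Unset Strict Implicit.
Unset Printing Implicit Defensive.

Import GRing.Theory GroupScope.
Local Open Scope group_scope.

(* A group K and an algebra L correspond to each other when there is an additive
   surjection pi : K -> L whose kernel is both the set of p-th powers and the set
   of elements killed by p, such that [x, y] = z^p as soon as
   pi z = pi x * pi y.  Lifting a basis of L to k_1, ..., k_r in K, every element
   of K is an ordered monomial k_1^a_1 ... k_r^a_r with exponents unique modulo
   p^2, and the collection formula shows that the product of two monomials
   depends only on the structure constants of L.  So K is determined by L, and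
   automorphisms of L lift to K; conversely L is determined by K, as the kernel
   of pi is.  Both the quotient H / N and, for a UCS group G, the projection of G
   to G / Phi(G) are of this kind, and for such a K characteristic subgroups map
   to subspaces of L stable under automorphisms, so that K is UCS when L is
   irreducible.  A group with a given algebra exists by Baer's construction. *)

(** * Vector spaces and algebras over the prime field *)

Section FpSpaces.
Variable p : nat.
Hypothesis p_pr : prime p.

Lemma scale_Fp_nat (V : lmodType 'F_p) (a : 'F_p) (x : V) :
  (a *: x = x *+ (a : nat))%R.
Proof. by rewrite -[in LHS](natr_Zp a) scaler_nat. Qed.

Lemma mulrn_Fp_mod (V : lmodType 'F_p) (x : V) n : (x *+ (n %% p) = x *+ n)%R.
Proof.
by rewrite -[RHS]scaler_nat scale_Fp_nat natFp.
Qed.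

Lemma mulrn_Fp_p (V : lmodType 'F_p) (x : V) : (x *+ p = 0)%R.
Proof. by rewrite -mulrn_Fp_mod modnn. Qed.

Lemma additive_mulrn (U V : zmodType) (f : U -> V) x n :
  {morph f : x y / (x + y)%R} -> (f (x *+ n) = f x *+ n)%R.
Proof.
move=> fD; elim: n => [|n IHn]; last by rewrite !mulrS fD IHn.
by apply: (addrI (f 0%R)); rewrite -fD !addr0.
Qed.

Lemma additive_Fp_linear (U V : lmodType 'F_p) (f : U -> V) :
  {morph f : x y / (x + y)%R} -> linear f.
Proof. by move=> fD a x y; rewrite fD !scale_Fp_nat additive_mulrn. Qed.

Lemma additive_Fp_linfun (U V : vectType 'F_p) (f : U -> V) :
  {morph f : x y / (x + y)%R} -> exists g : 'Hom(U, V), g =1 f.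
Proof.
move=> /additive_Fp_linear fL.
pose F := GRing.isLinear.Build _ _ _ _ f fL.
pose fl : {linear U -> V} := HB.pack f F.
by exists (linfun fl) => x; rewrite lfunE.
Qed.

(** Over ['F_p] a scalar multiple is a repeated sum, so a list closed under addition is its own
    span. *)
Lemma additive_Fp_subspace (V : vectType 'F_p) (s : seq V) :
  (0%R \in s) -> {in s &, forall x y, (x + y)%R \in s} ->
  exists U : {vspace V}, U =i s.
Proof.
move=> s0 sD; exists <<s>>%VS => u; apply/idP/idP; last exact: memv_span.
rewrite -[X in <<X>>%VS]/(tval (in_tuple s)) => /coord_span->.
apply: (big_ind (fun x => x \in s)) => // i _.
rewrite scale_Fp_nat; move: (nat_of_ord (coord _ _ _)) => n.
by elim: n => // n IHn; rewrite mulrS sD ?mem_nth.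
Qed.

Lemma alg_isomorphicP (L M : algebra 'F_p) (f : L -> M) :
  {morph f : x y / (x + y)%R} -> {morph f : x y / alg_mul x y} ->
  bijective f -> exists g : 'Hom(L, M), is_alg_iso g /\ g =1 f.
Proof.
move=> /additive_Fp_linfun[g gf] fM fB; exists g; split=> //; split.
  exact: eq_bij fB _ (fsym gf).
by move=> x y; rewrite !gf fM.
Qed.

Lemma alg_isomorphic_refl (L : algebra 'F_p) : alg_isomorphic L L.
Proof.
have [|||g [g_iso _]] := @alg_isomorphicP L L id; last by exists g.
- by [].
- by [].
- by exists id.
Qed.

Lemma alg_isomorphic_sym (L M : algebra 'F_p) :
  alg_isomorphic L M -> alg_isomorphic M L.
Proof.
case=> f [[g fK gK] fM].
have gD : {morph g : x y / (x + y)%R}.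
  by move=> x y; apply: (can_inj fK); rewrite gK linearD /= !gK.
have gM : {morph g : x y / alg_mul x y}.
  by move=> x y; apply: (can_inj fK); rewrite fM !gK.
have [|h [h_iso _]] := alg_isomorphicP gD gM; first by exists f.
by exists h.
Qed.

Lemma alg_isomorphic_trans (L M N : algebra 'F_p) :
  alg_isomorphic L M -> alg_isomorphic M N -> alg_isomorphic L N.
Proof.
case=> f [fB fM] [g [gB gM]].
have [|||h [h_iso _]] := @alg_isomorphicP L N (g \o f).
- by move=> x y; rewrite /= !linearD.
- by move=> x y; rewrite /= fM gM.
- exact: bij_comp.
by exists h.
Qed.

End FpSpaces.

(** * Ordered monomials in the variety *)

Section PlainMorphisms.
Variables (K K' : groupType) (f : K -> K').
Hypothesis fM : {morph f : x y / x * y}.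

Lemma mulg_morph1 : f 1 = 1.
Proof. by apply: (mulgI (f 1)); rewrite -fM !mulg1. Qed.

Lemma mulg_morphV x : f x^-1 = (f x)^-1.
Proof. by apply: (mulgI (f x)); rewrite -fM !mulgV mulg_morph1. Qed.

Lemma mulg_morphX x n : f (x ^+ n) = f x ^+ n.
Proof. by elim: n => [|n IHn]; rewrite ?mulg_morph1 // !expgS fM IHn. Qed.

Lemma mulg_morphR x y : f [~ x, y] = [~ f x, f y].
Proof. by rewrite /commg /conjg !fM !mulg_morphV. Qed.

Lemma mulg_morph_prod (I : Type) (s : seq I) (P : pred I) (F : I -> K) :
  f (\prod_(i <- s | P i) F i) = \prod_(i <- s | P i) f (F i).
Proof. exact: (big_morph f fM mulg_morph1). Qed.

Lemma mulg_morph_pows r (k : 'I_r -> K) a : f (pows k a) = pows (f \o k) a.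
Proof.
by rewrite mulg_morph_prod; apply: eq_bigr => i _; rewrite mulg_morphX.
Qed.

Lemma in_variety_inj p : injective f -> in_variety p K' -> in_variety p K.
Proof.
move=> f_inj [e c z]; split=> [x|x y t|x y]; apply: f_inj.
- by rewrite mulg_morphX e mulg_morph1.
- by rewrite !mulg_morphR c mulg_morph1.
by rewrite !fM mulg_morphX; apply: z.
Qed.

Lemma in_variety_surj p :
  (forall y, exists x, y = f x) -> in_variety p K -> in_variety p K'.
Proof.
move=> f_surj [e c z]; split=> [x|x y t|x y].
- by have [x' ->] := f_surj x; rewrite -mulg_morphX e mulg_morph1.
- have [[x' ->] [y' ->]] := conj (f_surj x) (f_surj y).
  have [t' ->] := f_surj t.
  by rewrite -!mulg_morphR c mulg_morph1.
have [[x' ->] [y' ->]] := conj (f_surj x) (f_surj y).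
by rewrite -mulg_morphX /commute -!fM z.
Qed.

End PlainMorphisms.

(** * Multiplication of ordered monomials *)

Section VarietyPowers.
Variables (p : nat) (K : groupType) (r : nat) (k : 'I_r -> K).
Hypothesis varK : in_variety p K.
Implicit Types a b d : 'I_r -> nat.

Definition cpows d : K := \prod_(i < r) (k i ^+ p) ^+ d i.

Lemma commute_expp (x y : K) : commute (x ^+ p) y.
Proof. by case: varK. Qed.

Lemma cpows_central d (z : K) : commute z (cpows d).
Proof.
by apply: commute_prod => i _; apply/commuteX/commute_sym/commute_expp.
Qed.

Lemma eq_cpows d d' : d =1 d' -> cpows d = cpows d'.
Proof. by move=> dd'; apply: eq_bigr => i _; rewrite dd'. Qed.

Lemma cpowsD d d' : cpows (fun i => d i + d' i)%N = cpows d * cpows d'.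
Proof.
rewrite /cpows -prodgM_commute => [|i j _ _].
  by apply: eq_bigr => i _; rewrite expgnDr.
exact/commuteX/commute_sym/commuteX/commute_sym/commute_expp.
Qed.

Lemma cpows0 : cpows (fun=> 0%N) = 1.
Proof. by apply: big1. Qed.

Lemma cpowsX d n : cpows d ^+ n = cpows (fun i => n * d i)%N.
Proof.
elim: n => [|n IHn]; first by rewrite expg0 -cpows0; apply: eq_cpows.
by rewrite expgS IHn -cpowsD; apply: eq_cpows => i; rewrite mulSn.
Qed.

Lemma cpows_sum (I : Type) (s : seq I) (P : pred I) (F : I -> 'I_r -> nat) :
  \prod_(i <- s | P i) cpows (F i)
    = cpows (fun l => \sum_(i <- s | P i) F i l)%N.
Proof.
elim: s => [|i s IHs].
  by rewrite big_nil -cpows0; apply: eq_cpows => l; rewrite big_nil.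
rewrite big_cons IHs -cpowsD.
by case: ifP => Pi; apply: eq_cpows => l; rewrite big_cons Pi.
Qed.

Lemma pows_mod a b : (forall i, a i = b i %[mod p ^ 2]) -> pows k a = pows k b.
Proof.
move=> ab; apply: eq_bigr => i _.
by rewrite -(expg_modp2 varK) ab (expg_modp2 varK).
Qed.

Lemma pows_mul_cpows a d :
  pows k a * cpows d = pows k (fun i => a i + p * d i)%N.
Proof.
rewrite /pows /cpows -prodgM_commute => [|i j _ _].
  by apply: eq_bigr => i _; rewrite expgnDr expgnA.
exact/commuteX/commute_sym/commute_expp.
Qed.

Lemma pows_delta i : pows k (fun j => j == i) = k i.
Proof.
rewrite -[RHS](big_pred1_eq mulg i k) [RHS]big_mkcond.
by apply: eq_bigr => j _; case: eqP.
Qed.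

Definition comm_rel (c : 'I_r -> 'I_r -> 'I_r -> nat) :=
  forall i j : 'I_r, j < i -> [~ k i, k j] = cpows (c i j).

(* The exponents of a product of ordered monomials depend on [K] and [k] only
   through [c]. *)
Definition pows_law c a b (l : 'I_r) : nat :=
  a l + b l + p * \sum_(i < r) \sum_(j < r | j < i) a i * b j * c i j l.

(** Collection leaves a product of commutators; [relc] turns each into central p-th powers, which
    the exponents absorb with a factor [p]. *)
Lemma pows_lawP c a b :
  comm_rel c -> pows k a * pows k b = pows k (pows_law c a b).
Proof.
move=> relc; rewrite (powsM varK) -pows_mul_cpows; congr (_ * _).
rewrite /comms -cpows_sum; apply: eq_bigr => i _.
rewrite -cpows_sum; apply: eq_bigr => j lt_ji.
by rewrite relc // cpowsX.
Qed.

End VarietyPowers.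

(** Monomials with the same exponents are matched: the same coincidences on both sides make this
    well defined and injective, the common [c] makes it multiplicative. *)
Lemma pows_iso p (K K' : groupType) r (k : 'I_r -> K) (k' : 'I_r -> K') c :
  in_variety p K -> in_variety p K' -> comm_rel p k c -> comm_rel p k' c ->
  (forall x, exists a, x = pows k a) -> (forall x, exists a, x = pows k' a) ->
  (forall a b, pows k a = pows k b <-> pows k' a = pows k' b) ->
  exists f : K -> K', [/\ {morph f : x y / x * y}, bijective f
    & forall a, f (pows k a) = pows k' a].
Proof.
move=> varK varK' relK relK' /choice[s sK] /choice[s' sK'] eqKK'.
pose f x := pows k' (s x).
have fE a : f (pows k a) = pows k' a by apply/eqKK'; rewrite -sK.
exists f; split=> // [x y|].
  by rewrite (sK x) (sK y) (pows_lawP varK _ _ relK) !fE (pows_lawP varK' _ _ relK').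
exists (fun y => pows k (s' y)) => [x|y].
  by rewrite [RHS]sK; apply/eqKK'; rewrite -sK'.
by rewrite fE -sK'.
Qed.

(** * Groups with a root map *)

(* [pi] exhibits [L] as the algebra of [K] independently of any chosen
   representatives: its kernel is the group of [p]-th powers and
   [[x, y]^(1/p)] is [pi x * pi y]. *)
Record root_map (p : nat) (K : finGroupType) (L : algebra 'F_p) (pi : K -> L) :
    Prop := RootMap {
  rm_variety : in_variety p K;
  rm_morph : {morph pi : x y / x * y >-> (x + y)%R};
  rm_surj : forall u, exists x, pi x = u;
  rm_ker : forall x, x ^+ p = 1 <-> pi x = 0%R;
  rm_expp : forall x, pi x = 0%R -> exists y, x = y ^+ p;
  rm_comm : forall x y z, pi z = alg_mul (pi x) (pi y) -> [~ x, y] = z ^+ p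
}.

Section RootMap.
Variable p : nat.
Hypotheses (p_pr : prime p) (p_odd : odd p).

(** In class two the defect is a commutator to the power p(p-1)/2. For odd p this is a multiple of
    p, and p kills commutators since p-th powers are central. *)
Lemma variety_expM (K : finGroupType) (varK : in_variety p K) :
  {morph (fun x : K => x ^+ p) : x y / x * y}.
Proof.
move=> x y; rewrite expMg_Rmul; last 2 first.
- exact: comm_central varK _ _ _.
- exact: comm_central varK _ _ _.
rewrite bin2odd // -(commg_modp varK) mulnC modnMl.
by rewrite mulg1.
Qed.

Section OneRootMap.
Variables (K : finGroupType) (L : algebra 'F_p) (pi : K -> L).
Hypothesis piP : root_map pi.

Let varK := rm_variety piP.
Let piM := rm_morph piP.
Let expM := variety_expM varK.

Lemma root_map1 : pi 1 = 0%R.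
Proof. by apply: (addrI (pi 1)); rewrite -piM mulg1 addr0. Qed.

Lemma root_mapV x : pi x^-1 = (- pi x)%R.
Proof. by apply: (addrI (pi x)); rewrite -piM mulgV root_map1 subrr. Qed.

Lemma root_mapX x n : pi (x ^+ n) = (pi x *+ n)%R.
Proof.
by elim: n => [|n IHn]; rewrite ?root_map1 // expgS mulrS piM IHn.
Qed.

Lemma root_map_expp x : pi (x ^+ p) = 0%R.
Proof. by rewrite root_mapX mulrn_Fp_p. Qed.

(** The p-th power map is a homomorphism with the same kernel as [pi], so the fibres agree. *)
Lemma root_map_eq x y : x ^+ p = y ^+ p <-> pi x = pi y.
Proof.
have expV : (x * y^-1) ^+ p = x ^+ p * (y ^+ p)^-1.
  by rewrite expM expVgn.
split=> [xy|xy].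
  apply/eqP; rewrite -subr_eq0 -root_mapV -piM; apply/eqP/(rm_ker piP).
  by rewrite expV xy mulgV.
have: (x * y^-1) ^+ p = 1 by apply/(rm_ker piP); rewrite piM root_mapV xy subrr.
by rewrite expV => /(canRL (mulgKV _)); rewrite mul1g.
Qed.

Lemma root_map_comm x y z :
  [~ x, y] = z ^+ p <-> pi z = alg_mul (pi x) (pi y).
Proof.
split; last exact: (rm_comm piP).
have [z0 z0E] := rm_surj piP (alg_mul (pi x) (pi y)).
by rewrite (rm_comm piP z0E) -z0E => /root_map_eq.
Qed.

(** In class two the commutator is multiplicative in each argument; taking p-th roots carries this
    over to the product, and [[~ x, x] = 1] gives alternation. *)
Lemma root_map_anticommutative : is_anticommutative L.
Proof.
have mulDr (u : L) : {morph @alg_mul _ L u : v w / (v + w)%R}.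
  move=> v w; have [x <-] := rm_surj piP u; have [y <-] := rm_surj piP v.
  have [z <-] := rm_surj piP w; rewrite -piM.
  have [a aE] := rm_surj piP (alg_mul (pi x) (pi y)).
  have [b bE] := rm_surj piP (alg_mul (pi x) (pi z)).
  rewrite -aE -bE -piM; symmetry; apply/root_map_comm.
  by rewrite (commg_mulr varK) (rm_comm piP aE) (rm_comm piP bE) expM.
have mulDl (w : L) : {morph (fun u => alg_mul u w) : u v / (u + v)%R}.
  move=> u v; have [x <-] := rm_surj piP u; have [y <-] := rm_surj piP v.
  have [z <-] := rm_surj piP w; rewrite -piM.
  have [a aE] := rm_surj piP (alg_mul (pi x) (pi z)).
  have [b bE] := rm_surj piP (alg_mul (pi y) (pi z)).
  rewrite -aE -bE -piM; symmetry; apply/root_map_comm.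
  by rewrite (commg_mull varK) (rm_comm piP aE) (rm_comm piP bE) expM.
split=> [u|w|u].
- exact: additive_Fp_linear.
- exact: (additive_Fp_linear (mulDl w)).
have [x <-] := rm_surj piP u; rewrite -root_map1; symmetry.
by apply/root_map_comm; rewrite commgg expg1n.
Qed.

(** * Coordinates with respect to a lifted basis *)

Section Basis.
Variables (r : nat) (v : r.-tuple L).
Hypothesis basv : basis_of fullv v.
Variable k : 'I_r -> K.
Hypothesis kE : forall i, pi (k i) = tnth v i.

Lemma root_map_pows a : pi (pows k a) = (\sum_(i < r) tnth v i *+ a i)%R.
Proof.
rewrite /pows (big_morph pi piM root_map1); apply: eq_bigr => i _.
by rewrite root_mapX kE.
Qed.

Lemma cpows_expp a : cpows p k a = pows k a ^+ p.
Proof.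
rewrite (mulg_morph_prod expM); apply: eq_bigr => i _.
by rewrite -!expgnA mulnC.
Qed.

Lemma sum_coord_basis (u : L) :
  (\sum_(i < r) tnth v i *+ (coord v i u : nat) = u)%R.
Proof.
rewrite [RHS](coord_basis basv (memvf u)); apply: eq_bigr => i _.
by rewrite scale_Fp_nat (tnth_nth 0%R).
Qed.

Lemma root_map_comm_rel i j : [~ k i, k j] = cpows p k (struct_coef v i j).
Proof.
rewrite cpows_expp; apply/root_map_comm.
by rewrite root_map_pows sum_coord_basis !kE.
Qed.

(** The coordinates of [pi y] give a monomial equal to [y] up to a p-th power. Applied to [x] and
    then to the root so found, this reaches [x] up to a [p ^ 2]-th power, which is trivial. *)
Lemma pows_onto x : exists a, x = pows k a.
Proof.
have pw y : exists a, exists z, y = pows k a * z ^+ p.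
  exists (fun i => coord v i (pi y) : nat); set w := pows k _.
  have [|z zE] := rm_expp piP (x := w^-1 * y).
    by rewrite piM root_mapV root_map_pows sum_coord_basis addNr.
  by exists z; rewrite -zE mulKVg.
have [a [y ->]] := pw x; have [b [z ->]] := pw y.
have zp2 : z ^+ p ^+ p = 1 by apply/(rm_ker piP)/root_map_expp.
exists (fun i => a i + p * b i)%N.
by rewrite -(pows_mul_cpows k varK) cpows_expp expM zp2 mulg1.
Qed.

Lemma pows_modp a b : pi (pows k a) = pi (pows k b) ->
  forall i, a i = b i %[mod p].
Proof.
have freev := basis_free basv.
have coordE c i : coord v i (pi (pows k c)) = (c i)%:R%R.
  rewrite root_map_pows; under eq_bigr do
    rewrite (tnth_nth 0%R) -scaler_nat.
  exact: coord_sum_free.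
move=> ab i; rewrite -!(natFp p_pr); congr (nat_of_ord _).
by rewrite -!coordE ab.
Qed.

(** Exponents are split in base p: [pi] reads the low digit; once the low parts are cancelled, a
    p-th power remains, whose root is again read by [pi]. *)
Lemma pows_eq a b :
  pows k a = pows k b <-> forall i, a i = b i %[mod p ^ 2].
Proof.
split=> [ab i|]; last exact: pows_mod.
pose q (a : 'I_r -> nat) i := a i %/ p; pose m (a : 'I_r -> nat) i := a i %% p.
have split_pows c : pows k c = pows k (m c) * pows k (q c) ^+ p.
  rewrite -cpows_expp (pows_mul_cpows k varK); apply: eq_bigr => j _.
  by rewrite addnC mulnC -divn_eq.
have abm := pows_modp (congr1 pi ab).
have mE : pows k (m a) = pows k (m b).
  by apply: eq_bigr => j _; rewrite /m abm.
have qE : a i %/ p = b i %/ p %[mod p].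
  have := ab; rewrite (split_pows a) (split_pows b) mE.
  by move=> /mulgI/root_map_eq/pows_modp/(_ i).
rewrite (divn_eq (a i) p) (divn_eq (b i) p) abm; apply/eqP.
by rewrite eqn_modDr -mulnn -!muln_modl qE.
Qed.

End Basis.
End OneRootMap.

(** Lifts of one basis of [L] give monomials in both groups that multiply by the same structure
    constants. *)
Lemma root_map_lift (K K' : finGroupType) (L : algebra 'F_p)
    (pi : K -> L) (pi' : K' -> L) :
  root_map pi -> root_map pi' ->
  exists f : K -> K', [/\ {morph f : x y / x * y}, bijective f
    & forall x, pi' (f x) = pi x].
Proof.
move=> piP piP'; pose v := vbasis (fullv : {vspace L}).
have basv : basis_of fullv v := vbasisP _.
have [k kE] := choice (fun i => rm_surj piP (tnth v i)).
have [k' kE'] := choice (fun i => rm_surj piP' (tnth v i)).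
have [|||||f [fM fB fE]] := @pows_iso p K K' _ k k' (struct_coef v)
  (rm_variety piP) (rm_variety piP').
- by move=> i j _; exact: (root_map_comm_rel piP basv kE).
- by move=> i j _; exact: (root_map_comm_rel piP' basv kE').
- exact: (pows_onto piP basv kE).
- exact: (pows_onto piP' basv kE').
- move=> a b; rewrite (pows_eq piP basv kE) (pows_eq piP' basv kE').
  by [].
exists f; split=> // x; have [a ->] := pows_onto piP basv kE x.
by rewrite fE (root_map_pows piP' kE') (root_map_pows piP kE).
Qed.

Lemma root_map_transport (K K' : finGroupType) (L : algebra 'F_p)
    (pi : K' -> L) (f : K -> K') :
  {morph f : x y / x * y} -> bijective f -> root_map pi -> root_map (pi \o f).
Proof.
move=> fM fB piP; have f_inj := bij_inj fB; have [g fK gK] := fB.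
split=> [|x y|u|x|x /= fx|x y z /= xyz].
- exact: (in_variety_inj fM f_inj (rm_variety piP)).
- by rewrite /= fM (rm_morph piP).
- by have [x <-] := rm_surj piP u; exists (g x); rewrite /= gK.
- rewrite /= -(rm_ker piP) -(mulg_morphX fM) -(mulg_morph1 fM).
  by split=> [->|/f_inj].
- have [y fxE] := rm_expp piP fx; exists (g y).
  by apply: f_inj; rewrite (mulg_morphX fM) gK.
by apply: f_inj; rewrite (mulg_morphR fM) (mulg_morphX fM) (rm_comm piP xyz).
Qed.

(** Together with [root_map_lift] this lifts isomorphisms of algebras, in particular automorphisms
    of [L], to the groups. *)
Lemma root_map_iso_alg (K : finGroupType) (L M : algebra 'F_p)
    (pi : K -> L) (g : 'Hom(L, M)) :
  is_alg_iso g -> root_map pi -> root_map (g \o pi).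
Proof.
case=> gB gM piP; have g_inj := bij_inj gB; have [h gK hK] := gB.
have g0 x : g x = 0%R <-> x = 0%R.
  by split=> [|->]; rewrite ?linear0 // -{1}[0%R](linear0 g) => /g_inj.
split=> [|x y|u|x|x /= fx|x y z /= xyz].
- exact: rm_variety piP.
- by rewrite /= (rm_morph piP) linearD.
- by have [x xE] := rm_surj piP (h u); exists x; rewrite /= xE hK.
- by rewrite /= g0; apply: rm_ker.
- by apply: (rm_expp piP); apply/g0.
by apply: (rm_comm piP); apply: g_inj; rewrite gM.
Qed.

(* Well defined because the kernel of a root map is [x ^+ p = 1], which depends
   only on the group. *)
Lemma root_map_descend (K K' : finGroupType) (L L' : algebra 'F_p)
    (pi : K -> L) (pi' : K' -> L') (f : K -> K') :
  root_map pi -> root_map pi' -> {morph f : x y / x * y} -> bijective f ->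
  exists g : 'Hom(L, L'), is_alg_iso g /\ forall x, g (pi x) = pi' (f x).
Proof.
move=> piP piP' fM fB; have f_inj := bij_inj fB; have [h fK hK] := fB.
have [s sE] := choice (rm_surj piP).
have eqK x y : pi x = pi y <-> pi' (f x) = pi' (f y).
  rewrite -(root_map_eq piP) -(root_map_eq piP') -!(mulg_morphX fM).
  by split=> [->|/f_inj].
pose g u := pi' (f (s u)).
have gE x : g (pi x) = pi' (f x) by apply/eqK; rewrite sE.
have [|||G [G_iso Gg]] := @alg_isomorphicP p L L' g.
- move=> u v; have [[x <-] [y <-]] := conj (rm_surj piP u) (rm_surj piP v).
  by rewrite -(rm_morph piP) !gE fM (rm_morph piP').
- move=> u v; have [[x <-] [y <-]] := conj (rm_surj piP u) (rm_surj piP v).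
  have [z zE] := rm_surj piP (alg_mul (pi x) (pi y)).
  rewrite -zE !gE; apply/(root_map_comm piP').
  by rewrite -(mulg_morphR fM) (rm_comm piP zE) (mulg_morphX fM).
- have [s' sE'] := choice (rm_surj piP').
  exists (fun u => pi (h (s' u))) => [u|u].
    by have [x <-] := rm_surj piP u; apply/eqK; rewrite hK sE' gE.
  by rewrite gE hK sE'.
by exists G; split=> // x; rewrite Gg gE.
Qed.

End RootMap.

(** * Baer groups *)

Section AnticommutativeAlgebra.
Variables (F : fieldType) (L : algebra F).
Hypothesis antiL : is_anticommutative L.

Lemma alg_mulDr (u : L) : {morph @alg_mul _ L u : x y / (x + y)%R}.
Proof.
by have [mr _ _] := antiL; move=> x y; rewrite -[x]scale1r mr !scale1r.
Qed.

Lemma alg_mulDl (u : L) : {morph (fun x => alg_mul x u) : x y / (x + y)%R}.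
Proof.
have [_ ml _] := antiL; move=> x y /=.
by rewrite -[x]scale1r; have /= -> := ml u 1%R x y; rewrite !scale1r.
Qed.

Lemma alg_mulC (x y : L) : (alg_mul x y + alg_mul y x = 0)%R.
Proof.
have [_ _ alt] := antiL; have := alt (x + y)%R.
by rewrite alg_mulDl !alg_mulDr !alt add0r addr0.
Qed.

End AnticommutativeAlgebra.

(** * The field of p elements inside the integers modulo the square of p *)

Section FpToZp2.
Variable p : nat.
Hypothesis p_pr : prime p.

Let p2_gt1 : 1 < p ^ 2.
Proof. by rewrite -(expn0 p) ltn_exp2l // prime_gt1. Qed.

(** The isomorphism of ['F_p] onto the multiples of p; after [red] it is multiplication by p. *)
Definition mulp (c : 'F_p) : 'Z_(p ^ 2) := (p * c)%:R%R.

Lemma mulp_natr n : mulp n%:R%R = (p * n)%:R%R.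
Proof.
by rewrite /mulp natFp // muln_modr mulnn -(Zp_nat_mod p2_gt1 (p * n)).
Qed.

Lemma mulpD : {morph mulp : c d / (c + d)%R}.
Proof.
by move=> c d; rewrite -[c]natr_Zp -[d]natr_Zp -natrD !mulp_natr mulnDr natrD.
Qed.

Lemma mulp_red a : mulp (red a) = (a *+ p)%R.
Proof. by rewrite /red mulp_natr natrM natr_Zp mulr_natl. Qed.

Lemma red_mulp c : red (mulp c) = 0%R.
Proof. by rewrite /mulp red_natr // natrM pchar_Fp_0 // mul0r. Qed.

Lemma mulp_inj : injective mulp.
Proof.
move=> c d /(congr1 (fun a : 'Z_(p ^ 2) => a : nat)).
rewrite /mulp !(val_Zp_nat p2_gt1) -mulnn -!muln_modr.
move/eqP; rewrite eqn_pmul2l ?prime_gt0 // => /eqP cd.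
by rewrite -[c]natr_Zp -[d]natr_Zp; apply: val_inj; rewrite /= !natFp.
Qed.

Lemma red_eq0 (a : 'Z_(p ^ 2)) : red a = 0%R -> exists b, a = (b *+ p)%R.
Proof.
move=> a0; exists (a %/ p)%:R%R; rewrite -mulrnA -[LHS]natr_Zp; congr _%:R%R.
apply/esym/divnK/eqP; rewrite -(natFp p_pr).
by rewrite -[_%:R%R]/(red a) a0.
Qed.

End FpToZp2.

(* With the factor 1/2 the commutator is exactly [p] times a lift of the product
   of [L]; as [alg_mul x x = 0], powers for the twisted product are multiples in
   the additive group. *)
Section BaerGroup.
Variables (p : nat) (L : algebra 'F_p).
Hypotheses (p_pr : prime p) (p_odd : odd p) (antiL : is_anticommutative L).

Let v := vbasis (fullv : {vspace L}).
Let basv : basis_of fullv v := vbasisP _.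

Definition baer : Type := 'rV['Z_(p ^ 2)]_(\dim (fullv : {vspace L})).
HB.instance Definition _ := Finite.on baer.

Definition baer_proj (a : baer) : L := (\sum_i red (a 0 i) *: v`_i)%R.

Definition baer_mulp (u : L) : baer := (\row_i mulp (coord v i u))%R.

Definition baer_comm (a b : baer) : baer :=
  baer_mulp (2%:R^-1 *: alg_mul (baer_proj a) (baer_proj b))%R.

Definition baer_mul (a b : baer) : baer := (a + b + baer_comm a b)%R.
Definition baer_one : baer := 0%R.
Definition baer_inv (a : baer) : baer := (- a)%R.

Lemma baer_projD : {morph baer_proj : a b / (a + b)%R}.
Proof.
move=> a b; rewrite /baer_proj -big_split; apply: eq_bigr => i _.
by rewrite !mxE red_is_additive // scalerDl.
Qed.

Lemma baer_proj0 : baer_proj 0%R = 0%R.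
Proof. by apply: (addrI (baer_proj 0%R)); rewrite -baer_projD !addr0. Qed.

Lemma coord_baer_proj i a : coord v i (baer_proj a) = red (a 0%R i).
Proof. exact/coord_sum_free/basis_free/basv. Qed.

Lemma baer_mulpD : {morph baer_mulp : u w / (u + w)%R}.
Proof. by move=> u w; apply/rowP=> i; rewrite !mxE linearD mulpD. Qed.

Lemma baer_mulp0 : baer_mulp 0%R = 0%R.
Proof. by apply: (addrI (baer_mulp 0%R)); rewrite -baer_mulpD !addr0. Qed.

Lemma baer_mulp_proj a : baer_mulp (baer_proj a) = (a *+ p)%R.
Proof.
apply/rowP=> i; by rewrite mxE coord_baer_proj mulp_red // mulmxnE.
Qed.

Lemma baer_proj_mulp u : baer_proj (baer_mulp u) = 0%R.
Proof. by rewrite /baer_proj big1 // => i _; rewrite mxE red_mulp ?scale0r. Qed.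

Lemma baer_mulp_inj : injective baer_mulp.
Proof.
move=> u w /rowP uw; rewrite (coord_basis basv (memvf u)).
rewrite (coord_basis basv (memvf w)); apply: eq_bigr => i _; congr (_ *: _)%R.
by apply: (mulp_inj p_pr); have := uw i; rewrite !mxE.
Qed.

Lemma baer_proj_eq0 a : baer_proj a = 0%R -> exists b, a = (b *+ p)%R.
Proof.
move=> a0; have ai i : exists b, a 0%R i = (b *+ p)%R.
  by apply: red_eq0 => //; rewrite -coord_baer_proj a0 linear0.
have [b bE] := choice ai; exists (\row_i b i)%R.
by apply/rowP=> i; rewrite bE mulmxnE mxE.
Qed.

Lemma baer_proj_surj u : exists a, baer_proj a = u.
Proof.
exists (\row_i (coord v i u : nat)%:R)%R.
rewrite [RHS](coord_basis basv (memvf u)); apply: eq_bigr => i _.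
by rewrite mxE red_natr // natr_Zp.
Qed.

Lemma baer_commDl a b d :
  baer_comm (a + b)%R d = (baer_comm a d + baer_comm b d)%R.
Proof. by rewrite /baer_comm baer_projD (alg_mulDl antiL) scalerDr baer_mulpD. Qed.

Lemma baer_commDr a b d :
  baer_comm a (b + d)%R = (baer_comm a b + baer_comm a d)%R.
Proof. by rewrite /baer_comm baer_projD (alg_mulDr antiL) scalerDr baer_mulpD. Qed.

Lemma baer_comm0r a : baer_comm a 0%R = 0%R.
Proof. by apply: (addrI (baer_comm a 0%R)); rewrite -baer_commDr !addr0. Qed.

Lemma baer_comm0l a : baer_comm 0%R a = 0%R.
Proof. by apply: (addrI (baer_comm 0%R a)); rewrite -baer_commDl !addr0. Qed.

Lemma baer_comm_projl a b : baer_proj a = 0%R -> baer_comm a b = 0%R.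
Proof.
by move=> a0; rewrite -(baer_comm0l b) /baer_comm a0 baer_proj0.
Qed.

Lemma baer_comm_projr a b : baer_proj b = 0%R -> baer_comm a b = 0%R.
Proof.
by move=> b0; rewrite -(baer_comm0r a) /baer_comm b0 baer_proj0.
Qed.

Lemma baer_commxx a : baer_comm a a = 0%R.
Proof.
have [_ _ alt] := antiL; rewrite -(baer_comm0r 0%R) /baer_comm alt.
by rewrite -(alt (baer_proj 0%R)).
Qed.

Lemma baer_commC a b : baer_comm b a = (- baer_comm a b)%R.
Proof.
apply/eqP; rewrite -addr_eq0 addrC; apply/eqP.
have := baer_commxx (a + b)%R; rewrite baer_commDl !baer_commDr.
by rewrite !baer_commxx addr0 add0r.
Qed.

Lemma baer_proj_comm a b : baer_proj (baer_comm a b) = 0%R.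
Proof. exact: baer_proj_mulp. Qed.

(** [baer_comm] is biadditive, and its values are killed by [baer_proj], so nested terms vanish. *)
Lemma baer_mulA : associative baer_mul.
Proof.
move=> a b d; rewrite /baer_mul !baer_commDl !baer_commDr.
rewrite (baer_comm_projr _ (baer_proj_comm _ _)).
rewrite (baer_comm_projl _ (baer_proj_comm _ _)).
rewrite !addr0 -!addrA; do 2!congr (_ + _)%R.
by rewrite [RHS]addrCA; congr (_ + _)%R; rewrite addrC -addrA.
Qed.

Lemma baer_mul1 : left_id baer_one baer_mul.
Proof. by move=> a; rewrite /baer_mul baer_comm0l add0r addr0. Qed.

Lemma baer_mulV : left_inverse baer_one baer_inv baer_mul.
Proof.
move=> a; rewrite /baer_mul addNr add0r.
apply: (addIr (baer_comm a a)).
by rewrite -baer_commDl addNr baer_comm0l baer_commxx addr0.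
Qed.

HB.instance Definition _ :=
  Finite_isGroup.Build baer baer_mulA baer_mul1 baer_mulV.

Lemma baer_mulE (a b : baer) : a * b = (a + b + baer_comm a b)%R :> baer.
Proof. by []. Qed.

Lemma baer_expE (a : baer) n : a ^+ n = (a *+ n)%R :> baer.
Proof.
elim: n => // n IHn; rewrite expgS IHn mulrS baer_mulE.
suff -> : baer_comm a (a *+ n)%R = 0%R by rewrite addr0.
elim: n {IHn} => [|n IHn]; first exact: baer_comm0r.
by rewrite mulrS baer_commDr baer_commxx IHn addr0.
Qed.

Lemma baer_expp (a : baer) : a ^+ p = baer_mulp (baer_proj a) :> baer.
Proof. by rewrite baer_expE baer_mulp_proj. Qed.

Lemma baer_central (a b : baer) : baer_proj a = 0%R -> commute a b.
Proof.
move=> a0; rewrite /commute !baer_mulE.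
by rewrite baer_comm_projl // baer_comm_projr // [(b + a)%R]addrC.
Qed.

Lemma baer_commgE (a b : baer) :
  [~ a, b] = baer_mulp (alg_mul (baer_proj a) (baer_proj b)) :> baer.
Proof.
apply: (mulgI (b * a)); rewrite -commgC !baer_mulE.
rewrite (baer_comm_projr _ (baer_proj_mulp _)) addr0 (baer_commC a b).
rewrite [(b + a)%R]addrC -!addrA; do 2!congr (_ + _)%R.
rewrite addrC; apply/eqP; rewrite -subr_eq opprK; apply/eqP.
(* By antisymmetry [baer_comm a b] occurs twice, so the two halves make one; 2 is invertible since p
   is odd. *)
rewrite /baer_comm -baer_mulpD -scalerDl; congr (baer_mulp _).
rewrite -[RHS]scale1r; congr (_ *: _)%R.
rewrite -mulr2n -[(_ *+ 2)%R]mulr_natr mulVf //.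
rewrite -(dvdn_pcharf (pchar_Fp p_pr)).
by rewrite (dvdn_prime2 p_pr) //; case: eqP p_odd => // ->.
Qed.

Lemma baer_variety : in_variety p baer.
Proof.
have expp0 (a : baer) : baer_proj (a ^+ p) = 0%R.
  by rewrite baer_expp baer_proj_mulp.
split=> [a|a b d|a b].
- rewrite expnSr expn1 expgnA; rewrite [LHS]baer_expp expp0.
  exact: baer_mulp0.
- by apply/eqP/commgP/baer_central; rewrite baer_commgE baer_proj_mulp.
exact: baer_central.
Qed.

Lemma baer_root_map : root_map (baer_proj : baer -> L).
Proof.
split=> [|a b|u|a|a a0|a b d abd].
- exact: baer_variety.
- by rewrite baer_mulE !baer_projD baer_proj_mulp addr0.
- exact: baer_proj_surj.
- rewrite baer_expp; split=> [|->]; last exact: baer_mulp0.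
  by rewrite -[1]baer_mulp0 => /baer_mulp_inj.
- by have [b ->] := baer_proj_eq0 a0; exists b; rewrite baer_expE.
by rewrite baer_commgE baer_expp abd.
Qed.

End BaerGroup.

Lemma root_map_exists p (L : algebra 'F_p) :
  prime p -> odd p -> is_anticommutative L ->
  exists (K : finGroupType) (pi : K -> L), root_map pi.
Proof.
move=> p_pr p_odd antiL.
exact: ex_intro _ _ (ex_intro _ _ (baer_root_map p_pr p_odd antiL)).
Qed.

(** * Irreducible algebras give UCS groups *)

(** An injective endomorphism of a finite group is an automorphism, so plain injective functions
    serve as tests. *)
Lemma char_setTP (gT : finGroupType) (H : {group gT}) :
  H \char [set: gT] <->
  forall f : gT -> gT, {morph f : x y / x * y} -> injective f ->
    forall x, x \in H -> f x \in H.
Proof.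
split=> [/charP[_ fixH] f fM f_inj x Hx|fixH].
  have fM' : {in [set: gT] &, {morph f : x y / x * y}} by move=> ? ? _ _.
  have injF : 'injm (Morphism fM') by apply/injmP=> y z _ _ /f_inj.
  rewrite -(fixH (Morphism fM')) //; last first.
    by apply/eqP; rewrite eqEcard subsetT card_injm ?subsetT //=.
  by apply: (mem_morphim (Morphism fM')); rewrite ?inE.
apply/charP; split=> [|f injf _]; first exact: subsetT.
apply/eqP; rewrite eqEcard card_injm ?subsetT // leqnn andbT.
apply/subsetP=> _ /morphimP[x _ Hx ->]; apply: fixH => // [y z|y z fyz].
  by rewrite morphM ?inE.
by apply: (injmP injf); rewrite ?inE.
Qed.

Section RootMapUCS.
Variables (p : nat) (p_pr : prime p) (p_odd : odd p).
Variables (K : finGroupType) (L : algebra 'F_p) (pi : K -> L).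
Hypotheses (piP : root_map pi) (irrL : aut_irreducible L).

Let expM := variety_expM p_odd (rm_variety piP).

(** For [H = 1] this is the kernel of [pi]; in general it examines an [H] inside that kernel through
    its p-th roots. *)
Lemma group_set_pre_expp (H : {group K}) : group_set [set x | x ^+ p \in H].
Proof.
apply/group_setP; split=> [|x y]; rewrite !inE ?expg1n //.
by rewrite expM; apply: groupM.
Qed.

Lemma pre_expp_char (H : {group K}) :
  H \char [set: K] -> Group (group_set_pre_expp H) \char [set: K].
Proof.
move=> /char_setTP chH; apply/char_setTP=> f fM f_inj x; rewrite !inE => Hx.
by rewrite -(mulg_morphX fM) chH.
Qed.

(** The image of [H] is a subspace, stable under automorphisms of [L] because each lifts to an
    automorphism of [K], which preserves [H]. Irreducibility then decides. *)
Lemma root_map_char_image (H : {group K}) : H \char [set: K] ->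
  (forall x, x \in H -> pi x = 0%R) \/ (forall u, exists2 x, x \in H & pi x = u).
Proof.
move=> /char_setTP chH; pose s := [seq pi x | x in H].
have [||U Us] := @additive_Fp_subspace p L s.
- by apply/imageP; exists 1; rewrite ?group1 // (root_map1 piP).
- move=> _ _ /imageP[x Hx ->] /imageP[y Hy ->]; apply/imageP.
  by exists (x * y); rewrite ?groupM // (rm_morph piP).
have [nzL irr] := irrL; case: (irr U) => [f f_iso|U0|UT].
- apply/subvP=> _ /memv_imgP[u Uu ->].
  have [x Hx ->] : exists2 x, x \in H & u = pi x by apply/imageP; rewrite -Us.
  have [g [gM gB gE]] :=
    root_map_lift p_pr p_odd (root_map_iso_alg f_iso piP) piP.
  rewrite Us; apply/imageP; exists (g x); last by rewrite gE.
  exact: chH gM (bij_inj gB) _ Hx.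
- left=> x Hx; apply/eqP; rewrite -memv0 -U0 Us.
  by apply/imageP; exists x.
right=> u; have /imageP[x Hx ->] : u \in s by rewrite -Us UT memvf.
by exists x.
Qed.

Lemma root_map_ucs : is_ucs_p2 p [set: K].
Proof.
pose P := Group (group_set_pre_expp 1).
have memP x : (x \in P) = (x ^+ p == 1) by rewrite !inE.
have kerP x : x \in P <-> pi x = 0%R.
  by rewrite -(rm_ker piP) memP; split=> /eqP.
have [x0 px0] : exists x, pi x != 0%R.
  have [nzL _] := irrL; pose u := vpick (fullv : {vspace L}).
  have [x xE] := rm_surj piP u; exists x.
  by rewrite xE vpick0; apply/eqP.
have xp0 : x0 ^+ p != 1 by apply: contraNneq px0 => /(rm_ker piP) ->.
have charP' : P \char [set: K].
  apply: pre_expp_char; exact: char1.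
have ntP : P :!=: 1.
  apply: contraNneq xp0 => P1; rewrite -in_set1 -[[set 1]]P1.
  by apply/kerP/(root_map_expp p_pr piP).
have prP : P \proper [set: K].
  by rewrite properT; apply: contraNneq xp0 => PT; rewrite -memP PT inE.
apply/andP; split; last first.
  have expK : exponent [set: K] %| p ^ 2.
    by apply/exponentP=> x _; have [-> _ _] := rm_variety piP.
  have /dvdn_pfactor := expK; case/(_ p_pr)=> m le_m2 expE.
  rewrite expE eqn_exp2l ?prime_gt1 // eqn_leq le_m2 ltnNge.
  apply: contraNN xp0 => le_m1.
  rewrite -[p]expn1 -(subnKC le_m1) expnD expgnA -expE.
  by rewrite expg_exponent ?inE // expg1n.
apply/cards1P; exists P; apply/setP=> H; rewrite !inE.
apply/idP/eqP => [/and3P[chH ntH prH]|->]; last first.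
  by rewrite charP' ntP.
(* If [H] maps onto [L], every p-th power is the p-th power of an element of [H]; so [H] contains
   the kernel of [pi] and is all of [K]. *)
have [H0|HT] := root_map_char_image chH; last first.
  have expH y : y ^+ p \in H.
    have [h Hh] := HT (pi y); move/(root_map_eq p_odd piP) <-.
    exact: groupX.
  case/negP: (proper_subn prH); apply/subsetP=> y _.
  have [h Hh hy] := HT (pi y); rewrite -(mulKVg h y) groupMl //.
  have [|z ->] := rm_expp piP (x := h^-1 * y); last exact: expH.
  by rewrite (rm_morph piP) (root_mapV piP) hy addNr.
have sHP : H \subset P by apply/subsetP=> x /H0 /kerP.
(* The dichotomy is applied to the p-th roots of [H]: if all lie in the kernel, [H] is trivial;
   otherwise [H] contains every p-th power, hence [P]. *)
have [H'0|H'T] := root_map_char_image (pre_expp_char chH).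
  case/negP: ntH; rewrite -subG1; apply/subsetP=> x Hx.
  have [y xE] := rm_expp piP (H0 x Hx); rewrite inE xE.
  by apply/eqP/(rm_ker piP)/H'0; rewrite inE -xE.
apply/val_inj/eqP; rewrite eqEsubset sHP.
apply/subsetP=> x /kerP/(rm_expp piP)[y ->].
have [z] := H'T (pi y); rewrite inE => Hz.
by move/(root_map_eq p_odd piP) <-.
Qed.

End RootMapUCS.

(** * The algebra of a UCS group *)

Lemma ucs_char (gT : finGroupType) (G H P : {group gT}) :
  is_ucs G -> P \char G -> P :!=: 1 -> P \proper G ->
  H \char G -> [\/ H :=: 1, H :=: G | H :=: P].
Proof.
case/cards1P=> Q defQ chP ntP prP chH.
have QP : P = Q.
  by apply/set1P; rewrite -defQ inE chP ntP.
have [->|ntH] := eqVneq (H : {set gT}) 1; first by constructor 1.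
have [->|neqHG] := eqVneq (H : {set gT}) G; first by constructor 2.
constructor 3; rewrite QP; congr (gval _); apply/set1P.
by rewrite -defQ inE chH ntH properEneq neqHG char_sub.
Qed.

Section UCSGroup.
Variables (p : nat) (p_pr : prime p) (p_odd : odd p).
Variables (gT : finGroupType) (G : {group gT}) (ucsG : is_ucs_p2 p G).

Local Notation P := 'Phi(G).

Let pG : p.-group G := ucs_p2_pgroup p_pr ucsG.
Let expG : exponent G = (p ^ 2)%N. Proof. by case/andP: ucsG => _ /eqP. Qed.

Lemma ucs_not_exponent_p : ~~ (exponent G %| p).
Proof.
by rewrite expG -{2}[p]expn1 dvdn_Pexp2l // prime_gt1.
Qed.

Let ntG : G :!=: 1.
Proof.
by apply: contraNneq ucs_not_exponent_p => ->; rewrite exponent1 dvd1n.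
Qed.

Let prP : P \proper G := Phi_proper ntG.

Let ntP : P != 1.
Proof.
apply: contraNneq ucs_not_exponent_p => P1.
by have /eqP := P1; rewrite (trivg_Phi pG) abelemE // => /andP[].
Qed.

Lemma ucs_charE (H : {group gT}) :
  H \char G -> [\/ H :=: 1, H :=: G | H :=: P].
Proof.
by have /andP[ucs _] := ucsG; apply: ucs_char; rewrite ?Phi_char.
Qed.

(** ['Ohm_1('Z(G))] is characteristic, nontrivial as [G] is a nontrivial p-group, and not [G] as the
    exponent is [p ^ 2]; so it is ['Phi(G)]. *)
Lemma ucs_Phi_center : P \subset 'Z(G) /\ forall x, x \in P -> x ^+ p = 1.
Proof.
have abZ : p.-abelem 'Ohm_1('Z(G)).
  by rewrite Ohm1_abelem ?center_abelian // (pgroupS (center_sub G)).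
have sOZ : 'Ohm_1('Z(G)) \subset 'Z(G) := Ohm_sub 1 _.
have chO : 'Ohm_1('Z(G)) \char G := char_trans (Ohm_char _ _) (center_char _).
have [/eqP|defG|defP] := ucs_charE chO.
- by rewrite Ohm1_eq1 (center_nil_eq1 (pgroup_nil pG)) (negPf ntG).
- case/negP: ucs_not_exponent_p; move: abZ; rewrite defG abelemE //.
  by case/andP.
by rewrite -defP; split=> // x; have /(abelemP p_pr)[_] := abZ; apply.
Qed.

Lemma ucs_Phi_expp x : x \in G -> x ^+ p \in P.
Proof.
move=> Gx; rewrite (Phi_joing pG); apply/(subsetP (joing_subr _ _)).
by rewrite -{1}[p]expn1 (Mho_p_elt 1) // (mem_p_elt pG).
Qed.

Lemma ucs_Phi_comm x y : x \in G -> y \in G -> [~ x, y] \in P.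
Proof.
move=> Gx Gy; rewrite (Phi_joing pG); apply/(subsetP (joing_subl _ _)).
exact: mem_commg.
Qed.

Lemma ucs_Phi_commute z x : z \in P -> x \in G -> commute z x.
Proof.
have [sPZ _] := ucs_Phi_center.
by move=> /(subsetP sPZ)/centerP[_ cz] Gx; apply: cz.
Qed.

Lemma ucs_variety : in_variety p (subg_of G).
Proof.
have sgM : {morph (@sgval gT G) : x y / x * y} by [].
have inG (x : subg_of G) : sgval x \in G := valP x.
split=> [x|x y z|x y]; apply: (can_inj (@sgvalK _ G)).
- rewrite (mulg_morphX sgM) -expG; exact: expg_exponent (valP x).
- rewrite !(mulg_morphR sgM); apply/eqP/commgP.
  by apply: ucs_Phi_commute; rewrite ?ucs_Phi_comm ?inG.
rewrite !sgM (mulg_morphX sgM); apply: ucs_Phi_commute; last exact: valP.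
exact/ucs_Phi_expp/valP.
Qed.

Lemma ucs_expM x y : x \in G -> y \in G -> (x * y) ^+ p = x ^+ p * y ^+ p.
Proof.
move=> Gx Gy; have := variety_expM p_odd ucs_variety (subg G x) (subg G y).
move/(congr1 val); rewrite /= !(mulg_morphX (f := @sgval gT G)) //=.
by rewrite !subgK.
Qed.

(** By [ucs_expM] the p-th powers form the subgroup ['Mho^1(G)]. It is characteristic, nontrivial by
    the exponent and inside ['Phi(G)], hence equal to it. *)
Lemma ucs_Phi_root x : x \in P -> exists2 y, y \in G & x = y ^+ p.
Proof.
have gM : group_set [set y ^+ p | y in G].
  apply/group_setP; split=> [|_ _ /imsetP[y Gy ->] /imsetP[z Gz ->]].
    by apply/imsetP; exists 1; rewrite ?expg1n.
  by apply/imsetP; exists (y * z); rewrite ?groupM ?ucs_expM.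
have defM : 'Mho^1(G) = [set y ^+ p | y in G].
  rewrite (MhoE 1 pG) expn1; exact: (genGid (Group gM)).
have [M1|MG|<-] := ucs_charE (Mho_char 1 G).
- case/negP: ucs_not_exponent_p; apply/exponentP=> y Gy; apply/set1gP.
  by rewrite -M1 /= defM; apply/imsetP; exists y.
- have /subsetPn[y Gy /negP[]] := proper_subn prP.
  move: Gy; rewrite -{1}MG /= defM => /imsetP[z Gz ->].
  exact: ucs_Phi_expp.
by rewrite /= defM => /imsetP[y Gy ->]; exists y.
Qed.

(** The elements killed by p form ['Ohm_1(G)], which is characteristic, nontrivial, and proper by
    the exponent. *)
Lemma ucs_Phi_ker x : x \in G -> x ^+ p = 1 -> x \in P.
Proof.
move=> Gx xp; have gO : group_set [set y in G | y ^+ p == 1].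
  apply/group_setP; split=> [|y z]; rewrite !inE ?group1 ?expg1n ?eqxx //.
  move=> /andP[Gy /eqP yp] /andP[Gz /eqP zp].
  by rewrite groupM //= ucs_expM // yp zp mulg1.
have defO : 'Ohm_1(G) = [set y in G | y ^+ p == 1].
  rewrite (OhmE 1 pG) expn1 -[RHS](genGid (Group gO)); congr <<_>>.
  by apply/setP=> y; rewrite !inE.
have [O1|OG|<-] := ucs_charE (Ohm_char 1 G).
- by have := Ohm1_eq1 G; rewrite O1 eqxx (negPf ntG).
- case/negP: ucs_not_exponent_p; apply/exponentP=> y.
  by rewrite -{1}OG /= defO inE => /andP[_ /eqP].
by rewrite /= defO inE Gx xp /=.
Qed.

Let abG := ucs_p2_abelem p_pr ucsG.
Let ntQ := ucs_p2_neq1 ucsG.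

(** [root_map] takes a group type, whence [subg_of G] in place of [G]. *)
Definition calL_proj (x : subg_of G) : calL p_pr ucsG :=
  abelem_rV abG ntQ (coset P (sgval x)).

Lemma coset_Phi_eq x y : x \in G -> y \in G ->
  coset P x = coset P y <-> exists2 z, z \in P & x = z * y.
Proof.
have nP : G \subset 'N(P) := gFnorm _ _.
move=> Gx Gy; split=> [|[z Pz ->]].
  move=> /(rcoset_kercosetP (subsetP nP _ Gx) (subsetP nP _ Gy)).
  by move=> /rcosetP[z Pz ->]; exists z.
by rewrite mkerl // ?ker_coset // ?(subsetP nP).
Qed.

(** Holds as ['Phi(G)] is central; it frees the product of [calL] from the representatives chosen by
    [repr]. *)
Lemma ucs_comm_coset x y x' y' :
  x \in G -> y \in G -> x' \in G -> y' \in G ->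
  coset P x = coset P x' -> coset P y = coset P y' -> [~ x, y] = [~ x', y'].
Proof.
have cPl z a b : z \in P -> a \in G -> b \in G -> [~ z * a, b] = [~ a, b].
  move=> Pz Ga Gb; have /commgP/eqP zb := ucs_Phi_commute Pz Gb.
  by rewrite commMgJ zb conj1g mul1g.
move=> Gx Gy Gx' Gy' /(coset_Phi_eq Gx Gx')[z Pz ->].
move=> /(coset_Phi_eq Gy Gy')[t Pt ->].
have Gt : t \in G by apply: (subsetP (Phi_sub G)).
by rewrite cPl ?groupM // -invg_comm cPl // invg_comm.
Qed.

Lemma pth_root_coset y : y \in G -> pth_root p G (y ^+ p) = coset P y.
Proof.
move=> Gy; rewrite /pth_root; case: pickP => [u|none] /=.
  case/andP=> _ /exists_inP[g Gg /andP[/eqP <- /eqP gy]].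
  apply/coset_Phi_eq => //; exists (g * y^-1); last by rewrite mulgKV.
  apply: ucs_Phi_ker; first by rewrite groupM ?groupV.
  by rewrite ucs_expM ?groupV // gy expVgn mulgV.
(* The default value of [pth_root] is excluded, the coset of [y] being a candidate. *)
have := none (coset P y); rewrite mem_quotient //=.
by move/exists_inP=> []; exists y; rewrite ?eqxx.
Qed.

(** The kernel is ['Phi(G)], already identified both with the p-th powers and with the elements
    killed by p. *)
Lemma calL_root_map : root_map calL_proj.
Proof.
have nP : G \subset 'N(P) := gFnorm _ _.
have inG (t : subg_of G) : sgval t \in G := valP t.
have nPx (x : subg_of G) : sgval x \in 'N(P) by apply/(subsetP nP)/valP.
have sgX (x : subg_of G) n : sgval (x ^+ n) = sgval x ^+ n.
  exact: (mulg_morphX (f := @sgval gT G)).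
have kerP (x : subg_of G) : calL_proj x = 0%R <-> sgval x \in P.
  split=> [|Px]; last by rewrite /calL_proj coset_id // abelem_rV_1.
  rewrite -(abelem_rV_1 abG ntQ) => /abelem_rV_inj eq1.
  apply: coset_idr (nPx x) (eq1 _ _); last exact: group1.
  by rewrite mem_quotient ?inG.
split=> [|x y|u|x|x|x y z].
- exact: ucs_variety.
- by rewrite /calL_proj /= morphM // abelem_rV_M ?mem_quotient ?inG.
- have := mem_rVabelem abG ntQ u; case/morphimP=> x _ Gx xE.
  exists (subg G x); rewrite /calL_proj subgK // -xE.
  exact: rVabelemK.
- rewrite kerP; split=> [xp|Px]; last first.
    have [_ e] := ucs_Phi_center; apply: val_inj => /=.
    by rewrite sgX e.
  apply: ucs_Phi_ker; first exact: valP.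
  by rewrite -sgX xp.
- move=> /kerP/ucs_Phi_root[y Gy xE]; exists (subg G y).
  by apply: val_inj; rewrite /= sgX subgK.
have reprG (t : subg_of G) : repr (coset P (sgval t)) \in G.
  have := coset_reprK (coset P (sgval t)).
  move/(rcoset_kercosetP (repr_coset_norm _) (nPx t))/rcosetP=> [h Ph ->].
  by rewrite groupM ?inG // (subsetP (Phi_sub G)).
rewrite /alg_mul /= /calL_proj !abelem_rV_K ?mem_quotient //.
rewrite (@ucs_comm_coset _ _ (sgval x) (sgval y)) ?coset_reprK //.
have [g Gg xyE] := ucs_Phi_root (ucs_Phi_comm (inG x) (inG y)).
rewrite xyE pth_root_coset // => /abelem_rV_inj zg.
have [|t Pt zE] := proj1 (@coset_Phi_eq (sgval z) g (inG z) Gg).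
  by apply: zg; rewrite mem_quotient.
apply: (can_inj (@sgvalK _ G)); rewrite sgX zE (mulg_morphR (f := @sgval gT G)) //.
have [sPZ e] := ucs_Phi_center.
by rewrite ucs_expM ?(subsetP (Phi_sub G) t) // (e t) // mul1g.
Qed.

Lemma ucs_subg_char (H : {group subg_of G}) : H \char [set: subg_of G] ->
  [\/ H :=: 1, H :=: setT
    | forall x, (x \in H) = (sgval x \in P)].
Proof.
move=> chH; pose sg := sgval_morphism G.
have injsg : 'injm sg by apply/injmP=> x y _ _; apply: (can_inj (@sgvalK _ G)).
have memH x : (sgval x \in sg @* H) = (x \in H).
  apply/idP/idP=> [/morphimP[y _ Hy]|Hx]; last by rewrite mem_morphim ?inE.
  by move/(can_inj (@sgvalK _ G))->.
have imG : sg @* [set: subg_of G] = G by rewrite im_sgval.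
have : sg @* H \char G.
  by rewrite -imG; apply: injm_char; rewrite ?subsetT.
case/ucs_charE=> /= H'.
- constructor 1; apply/eqP; rewrite -subG1; apply/subsetP=> x.
  by rewrite -memH H' => /set1gP x1; apply/set1gP/(can_inj (@sgvalK _ G)).
- constructor 2; apply/setP=> x; rewrite -memH H' inE; exact: valP.
by constructor 3=> x; rewrite -memH H'.
Qed.

(** Automorphisms of the group descend to the algebra, so an invariant subspace [U] has a
    characteristic preimage. This is trivial, everything or the kernel, so [U] is zero or full. *)
Lemma calL_IAC : is_IAC (calL p_pr ucsG).
Proof.
pose pi := calL_proj; have piP : root_map pi := calL_root_map.
split; first exact: (root_map_anticommutative p_odd piP).
split=> [L0|U Uinv].
  case/negP: (proper_subn prP); apply/subsetP=> x Gx.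
  apply: ucs_Phi_ker => //.
  have : pi (subg G x) = 0%R by apply/eqP; rewrite -memv0 -L0 memvf.
  move/(rm_ker piP)/(congr1 (@sgval _ G)).
  by rewrite (mulg_morphX (f := @sgval gT G)) // subgK.
have gH : group_set [set x | pi x \in U].
  apply/group_setP; split=> [|x y]; rewrite !inE.
    by rewrite (root_map1 piP) mem0v.
  by rewrite (rm_morph piP); apply: memvD.
have : Group gH \char [set: subg_of G].
  apply/char_setTP=> f fM f_inj x; rewrite !inE => Ux.
  have [g [g_iso gE]] := root_map_descend p_odd piP piP fM (injF_bij f_inj).
  by rewrite -gE (subvP (Uinv g g_iso)) // memv_img.
have onto u : exists x, pi x = u := rm_surj piP u.
have U0 : (forall x, pi x \in U -> pi x = 0%R) -> U = 0%VS.
  move=> kerU; apply/eqP; rewrite -subv0; apply/subvP=> u.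
  by have [x <-] := onto u; move=> /kerU ->; apply: mem0v.
case/ucs_subg_char=> /= [/setP H1|/setP HT|HP].
- left; apply: U0 => x; have := H1 x; rewrite inE => ->.
  by move/set1gP->; apply: root_map1.
- right; apply/vspaceP=> u; have [x <-] := onto u.
  by have := HT x; rewrite !inE => ->; rewrite memvf.
left; apply: U0 => x; have := HP x; rewrite inE => -> Px.
apply/(rm_ker piP)/(can_inj (@sgvalK _ G)).
by rewrite (mulg_morphX (f := @sgval gT G)) //; have [_ ->] := ucs_Phi_center.
Qed.

End UCSGroup.

(** * The group of an algebra *)

Section CalG.
Variables (p : nat) (p_pr : prime p) (p_odd : odd p).
Variables (L : algebra 'F_p) (r : nat) (v : r.-tuple L).
Hypothesis basv : basis_of fullv v.
Variables (K : finGroupType) (pi : K -> L) (k : 'I_r -> K).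
Hypotheses (piP : root_map pi) (kE : forall i, pi (k i) = tnth v i).

Let varK := rm_variety piP.

Let p2_gt1 : 1 < p ^ 2.
Proof. by rewrite -(expn0 p) ltn_exp2l // prime_gt1. Qed.

(** All commutators vanish, so exponents of monomials simply add modulo [p ^ 2]. *)
Lemma calG_abelian_iso : is_abelian_alg L ->
  exists f : {dffun forall i : 'I_r, 'Z_(p ^ 2)} -> K,
    {morph f : x y / x * y} /\ bijective f.
Proof.
move=> abL.
pose f (a : {dffun forall i : 'I_r, 'Z_(p ^ 2)}) := pows k (fun i => a i).
have rel0 : comm_rel p k (fun _ _ _ => 0%N).
  move=> i j _; rewrite cpows0 // -(expg1n _ p); apply: (rm_comm piP).
  by rewrite abL (root_map1 piP).
have f_inj : injective f.
  move=> a b /(pows_eq p_pr p_odd piP basv kE) ab; apply/ffunP=> i.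
  by rewrite -[a i]natr_Zp -[b i]natr_Zp -Zp_nat_mod // ab Zp_nat_mod.
exists f; split.
  move=> a b; rewrite /f (pows_lawP varK _ _ rel0); apply: (pows_mod _ varK) => i.
  rewrite dffunM -[(a i * b i)]/(a i + b i)%R ZpD // modn_mod; congr (_ %% _).
  rewrite /pows_law big1 => [|i1 _]; first by rewrite muln0 addn0.
  by rewrite big1 // => j _; rewrite muln0.
have s x : {a | f a = x}.
  apply: cid; have [a ->] := pows_onto p_pr p_odd piP basv kE x.
  exists [ffun i => (a i)%:R%R : 'Z_(p ^ 2)].
  by apply: (pows_mod _ varK) => i; rewrite ffunE val_Zp_nat // modn_mod.
exists (fun x => sval (s x)) => [a|x]; last exact: (svalP (s x)).
exact/f_inj/(svalP (s (f a))).
Qed.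

(** * The quotient of a relatively free group *)

Variable H : relfree p r.
Local Notation h := (@rf_gen _ _ H).
Local Notation N := (calG_ker v H).

Let varH := rf_variety H.

(** The universal map into [D] followed by the inclusion fixes the generators, so by uniqueness it
    is the identity. *)
Lemma relfree_gen (D : {group H}) : (forall i, h i \in D) -> forall x, x \in D.
Proof.
move=> Dh x; have sgM : {morph (@sgval _ D) : x y / x * y} by [].
have varD : in_variety p (subg_of D).
  exact: (in_variety_inj sgM (can_inj (@sgvalK _ D)) varH).
have [g [gM gh _]] := rf_universal H (fun i => subg D (h i)) varD.
have [e [_ _ uniq_e]] := rf_universal H h varH.
have <- : sgval (g x) = x; last exact: valP.
have -> : sgval (g x) = e x.
  apply: (uniq_e (sgval \o g)) => [y z|i] /=; first by rewrite gM.
  by rewrite gh subgK.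
by rewrite -(uniq_e id).
Qed.

Lemma calG_relE i j :
  calG_rel v H i j = [~ h i, h j]^-1 * cpows p h (struct_coef v i j).
Proof. by []. Qed.

Lemma calG_ker_center : N \subset 'Z([set: H]).
Proof.
rewrite gen_subG; apply/subsetP=> _ /imsetP[[i j] _ ->].
apply/centerP; split=> [|y _]; first exact: in_setT.
apply/commute_sym/commuteM; last exact: cpows_central.
exact/commuteV/(comm_central varH).
Qed.

Lemma calG_ker_norm x : x \in 'N(N).
Proof.
have /normal_norm/subsetP := sub_center_normal calG_ker_center.
by apply; apply: in_setT.
Qed.

Local Notation q := (coset N).

Lemma calG_cosetM : {morph q : x y / x * y}.
Proof. by move=> x y; rewrite morphM ?calG_ker_norm. Qed.

Lemma calG_variety : in_variety p (coset_of N).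
Proof.
apply: (in_variety_surj calG_cosetM) varH => y.
by exists (repr y); rewrite coset_reprK.
Qed.

Let antiL := root_map_anticommutative p_odd piP.

(** Needed because the relations are imposed for [i < j] while [comm_rel] asks for [j < i]; for
    integer representatives antisymmetry holds modulo p. *)
Lemma struct_coef_anti i j l :
  p %| struct_coef v i j l + struct_coef v j i l.
Proof.
by rewrite /dvdn -(natFp p_pr) natrD !natr_Zp -linearD (alg_mulC antiL) linear0.
Qed.

Lemma calG_comm_rel : comm_rel p (q \o h) (struct_coef v).
Proof.
have qcp d : cpows p (q \o h) d = q (cpows p h d).
  rewrite (mulg_morph_prod calG_cosetM); apply: eq_bigr => i _.
  by rewrite !(mulg_morphX calG_cosetM).
have lt_rel (i j : 'I_r) : i < j ->
    [~ q (h i), q (h j)] = cpows p (q \o h) (struct_coef v i j).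
  move=> lt_ij; have : q (calG_rel v H i j) = 1.
    by apply/coset_id/mem_gen/imsetP; exists (i, j); rewrite ?inE.
  rewrite calG_relE calG_cosetM (mulg_morphV calG_cosetM) -qcp.
  rewrite (mulg_morphR calG_cosetM) => /(canRL (mulKg _)).
  by rewrite mulg1 invgK.
move=> i j lt_ji /=; rewrite -invg_comm lt_rel //.
(* The summed exponents are multiples of p, so each factor is a power of a [p ^ 2]-th power. *)
apply/eqP; rewrite eq_invg_mul -(cpowsD _ calG_variety); apply/eqP.
rewrite /cpows big1 // => l _; have /dvdnP[m ->] := struct_coef_anti j i l.
have [e _ _] := calG_variety.
by rewrite mulnC expgnA -(expgnA _ p p) mulnn e expg1n.
Qed.

(** By [pows_lawP] the elements of [H] that map to monomials form a subgroup; it contains the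
    generators. *)
Lemma calG_onto x : exists a, x = pows (q \o h) a.
Proof.
have qM := calG_cosetM.
have gD : group_set [set x | `[< exists a, q x = pows (q \o h) a >]].
  apply/group_setP; split=> [|y z]; rewrite !inE.
    apply/asboolP; exists (fun=> 0%N).
    by rewrite (mulg_morph1 qM) /pows big1.
  move=> /asboolP[a ya] /asboolP[b zb]; apply/asboolP.
  rewrite qM ya zb (pows_lawP calG_variety _ _ calG_comm_rel).
  by eexists.
have := @relfree_gen (Group gD) _ (repr x); rewrite inE coset_reprK.
move=> D; apply/asboolP/D => i; rewrite inE; apply/asboolP.
by exists (fun j => j == i : nat); rewrite pows_delta.
Qed.

(** The relations generating [N] hold among the [k i] by [root_map_comm_rel]. *)
Lemma calG_ker_kills (f : H -> K) : {morph f : x y / x * y} ->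
  (forall i, f (h i) = k i) -> forall x, x \in N -> f x = 1.
Proof.
move=> fM fh x Nx; have gD : group_set [set x | f x == 1].
  apply/group_setP; split=> [|y z]; rewrite !inE; first by rewrite (mulg_morph1 fM).
  by rewrite fM => /eqP-> /eqP->; rewrite mulg1.
suff /subsetP/(_ x Nx) : N \subset Group gD by rewrite inE => /eqP.
rewrite gen_subG; apply/subsetP=> _ /imsetP[[i j] _ ->].
rewrite inE calG_relE fM (mulg_morphV fM) (mulg_morphR fM) !fh.
rewrite (root_map_comm_rel p_odd piP basv kE) (mulg_morph_prod fM) /=.
rewrite -eq_invg_mul invgK; apply/eqP; apply: eq_bigr => l _.
by rewrite !(mulg_morphX fM) fh.
Qed.

(** Monomials equal in the quotient are equal in [K], since the universal map from [H] kills [N];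
    conversely, equality in [K] fixes the exponents modulo [p ^ 2]. *)
Lemma calG_nonabelian_iso :
  exists f : coset_of N -> K, {morph f : x y / x * y} /\ bijective f.
Proof.
have [f [fM fh _]] := rf_universal H k varK.
have [|||||g [gM gB _]] := @pows_iso p (coset_of N) K r (q \o h) k
    (struct_coef v) calG_variety varK; last by exists g.
- exact: calG_comm_rel.
- by move=> i j _; apply: (root_map_comm_rel p_odd piP basv kE).
- exact: calG_onto.
- exact: (pows_onto p_pr p_odd piP basv kE).
move=> a b; split=> [|/(pows_eq p_pr p_odd piP basv kE)]; last first.
  exact: (pows_mod _ calG_variety).
rewrite -!(mulg_morph_pows calG_cosetM).
have fpows c : f (pows h c) = pows k c.
  by rewrite (mulg_morph_pows fM); apply: eq_bigr => i _; rewrite /= fh.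
move/(rcoset_kercosetP (calG_ker_norm _) (calG_ker_norm _))/rcosetP=> [n Nn abE].
by rewrite -!fpows abE fM (calG_ker_kills fM fh Nn) mul1g.
Qed.

End CalG.

(** [calG v H] is compared with the Baer group of [L], whose root map is transported. *)
Lemma calG_root_map p (L : algebra 'F_p) r (v : r.-tuple L) (H : relfree p r) :
  prime p -> odd p -> is_anticommutative L -> basis_of fullv v ->
  exists pi : calG v H -> L, root_map pi.
Proof.
move=> p_pr p_odd antiL basv.
have [K [pi piP]] := root_map_exists p_pr p_odd antiL.
have [k kE] := choice (fun i => rm_surj piP (tnth v i)).
have [f [fM fB]] : exists f : calG v H -> K, {morph f : x y / x * y} /\ bijective f.
  rewrite /calG; case: asboolP => [abL|_].
    exact: (calG_abelian_iso p_pr p_odd basv piP kE abL).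
  exact: (calG_nonabelian_iso p_pr p_odd basv piP kE).
by exists (pi \o f); apply: root_map_transport.
Qed.

(** * The correspondence *)

Lemma isog_setTP (K K' : finGroupType) :
  [set: K] \isog [set: K'] <->
  exists f : K -> K', {morph f : x y / x * y} /\ bijective f.
Proof.
split=> [/isogP[f injf imf]|[f [fM fB]]].
  have f_inj : injective f by move=> x y; apply: (injmP injf); rewrite inE.
  exists f; split=> [x y|]; first by rewrite morphM ?inE.
  apply: inj_card_bij f_inj _.
  by rewrite -(cardsT K) -(card_injm injf) ?subsetT // imf cardsT.
have fM' : {in [set: K] &, {morph f : x y / x * y}} by move=> ? ? _ _.
have injf : 'injm (Morphism fM') by apply/injmP=> y z _ _ /(bij_inj fB).
apply/isogP; exists (Morphism fM') => //; apply/eqP.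
by rewrite eqEcard subsetT card_injm // !cardsT (bij_eq_card fB) leqnn.
Qed.

Section Correspondence.
Variable p : nat.
Hypotheses (p_pr : prime p) (p_odd : odd p).

(** Isomorphisms lift and descend along root maps. Both round trips and both injectivity statements
    are instances of this. *)
Lemma root_map_isog (K K' : finGroupType) (L L' : algebra 'F_p)
    (pi : K -> L) (pi' : K' -> L') :
  root_map pi -> root_map pi' ->
  alg_isomorphic L L' <-> [set: K] \isog [set: K'].
Proof.
move=> piP piP'; rewrite isog_setTP; split=> [[g g_iso]|[f [fM fB]]].
  have [f [fM fB _]] := root_map_lift p_pr p_odd (root_map_iso_alg g_iso piP) piP'.
  by exists f.
have [g [g_iso _]] := root_map_descend p_odd piP piP' fM fB.
by exists g.
Qed.

(** The property passes through a group: a root map onto [L] followed by [g] is one onto [L']. *)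
Lemma alg_isomorphic_anticommutative (L L' : algebra 'F_p) :
  alg_isomorphic L L' -> is_anticommutative L -> is_anticommutative L'.
Proof.
move=> [g g_iso] /(root_map_exists p_pr p_odd)[K [pi piP]].
exact: (root_map_anticommutative p_odd (root_map_iso_alg g_iso piP)).
Qed.

Lemma calL_isog (gT hT : finGroupType) (G : {group gT}) (M : {group hT})
    (ucsG : is_ucs_p2 p G) (ucsM : is_ucs_p2 p M) :
  alg_isomorphic (calL p_pr ucsG) (calL p_pr ucsM) <-> G \isog M.
Proof.
rewrite (root_map_isog (calL_root_map p_pr p_odd ucsG)
                       (calL_root_map p_pr p_odd ucsM)).
have [sG sM] := (isog_subg G, isog_subg M).
split=> [GM|GM].
  exact: isog_trans (isog_trans sG GM) (isog_symr sM).
by rewrite -(isog_transl _ sG); apply: isog_trans GM sM.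
Qed.

Lemma calG_isog (L L' : algebra 'F_p) r r' (v : r.-tuple L) (v' : r'.-tuple L')
    (H : relfree p r) (H' : relfree p r') :
  is_anticommutative L -> is_anticommutative L' ->
  basis_of fullv v -> basis_of fullv v' ->
  alg_isomorphic L L' <-> [set: calG v H] \isog [set: calG v' H'].
Proof.
move=> aL aL' bv bv'.
have [pi piP] := calG_root_map H p_pr p_odd aL bv.
have [pi' piP'] := calG_root_map H' p_pr p_odd aL' bv'.
exact: root_map_isog piP piP'.
Qed.

Lemma calG_calL (gT : finGroupType) (G : {group gT}) (ucsG : is_ucs_p2 p G)
    r (v : r.-tuple (calL p_pr ucsG)) (H : relfree p r) :
  basis_of {:calL p_pr ucsG} v -> [set: calG v H] \isog G.
Proof.
move=> bv; have [antiL _] := calL_IAC p_pr p_odd ucsG.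
have [pi piP] := calG_root_map H p_pr p_odd antiL bv.
apply: isog_trans (isog_symr (isog_subg G)).
apply/(root_map_isog piP (calL_root_map p_pr p_odd ucsG)).
exact: alg_isomorphic_refl.
Qed.

(** The group has a root map onto [L] and, once known to be UCS, another onto its own algebra. *)
Lemma calL_calG (L : algebra 'F_p) (r : nat) (v : r.-tuple L) (H : relfree p r) :
  is_IAC L -> basis_of {:L} v ->
  exists ucsGL : is_ucs_p2 p [set: calG v H]%G, alg_isomorphic (calL p_pr ucsGL) L.
Proof.
move=> [antiL irrL] bv; have [pi piP] := calG_root_map H p_pr p_odd antiL bv.
have ucs := root_map_ucs p_pr p_odd piP irrL.
exists ucs; apply/(root_map_isog (calL_root_map p_pr p_odd ucs) piP).
by rewrite isog_sym; apply: isog_subg.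
Qed.

(** * Passage to isomorphism classes *)

Lemma group_class_eq (gT hT : finGroupType) :
  group_class gT = group_class hT <-> [set: gT] \isog [set: hT].
Proof.
split=> [gh|gh].
  by have : group_class gT gT by [exact: isog_refl]; rewrite gh.
apply/funext=> K; apply/propext; split=> Kiso.
  exact: isog_trans Kiso gh.
by apply: isog_trans Kiso _; rewrite isog_sym.
Qed.

Lemma alg_class_eq (L M : algebra 'F_p) :
  alg_class L = alg_class M <-> alg_isomorphic L M.
Proof.
split=> [LM|LM].
  by have : alg_class L L by [exact: alg_isomorphic_refl]; rewrite LM.
apply/funext=> K; apply/propext; split=> Kiso.
  exact: alg_isomorphic_trans Kiso LM.
exact: alg_isomorphic_trans Kiso (alg_isomorphic_sym LM).
Qed.

(** By [calG_isog] the choices of representative, basis and relatively free group do not affect the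
    class. *)
Lemma calG_classE (L : algebra 'F_p) r (v : r.-tuple L) (H : relfree p r) :
  is_IAC L -> basis_of fullv v ->
  calG_class (alg_class L) = group_class (calG v H).
Proof.
move=> [antiL _] bv; apply/funext=> K; apply/propext; split=> [|Kiso].
  case=> M [s [w [H' [ML bw Kiso]]]]; apply: isog_trans Kiso _.
  apply/(calG_isog _ _ _ antiL bw bv) => //.
  exact: alg_isomorphic_anticommutative (alg_isomorphic_sym ML) antiL.
by exists L, r, v, H; split=> //; apply: alg_isomorphic_refl.
Qed.

Lemma calL_classE (gT : finGroupType) (ucsG : is_ucs_p2 p [set: gT]%G) :
  calL_class p_pr (group_class gT) = alg_class (calL p_pr ucsG).
Proof.
apply/funext=> M; apply/propext; split=> [[hT [ucsH [hg Miso]]]|Miso].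
  by apply: alg_isomorphic_trans Miso _; apply/calL_isog.
by exists gT, ucsG; split=> //; apply: isog_refl.
Qed.

Lemma calG_class_bijective :
  bijective_between (IAC_p p) (UCS_p2 p) (@calG_class p).
Proof.
have basE (L : algebra 'F_p) : basis_of fullv (vbasis {:L}) := vbasisP _.
have relf r : relfree p r := relfree_model r p_pr.
split=> [_ [L iacL ->]|_ _ [L iacL ->] [M iacM ->]|_ [gT ucsG ->]].
- rewrite (calG_classE (relf _) iacL (basE L)).
  have [ucs _] := calL_calG (relf _) iacL (basE L).
  by exists (calG (vbasis {:L}) (relf _)).
- rewrite (calG_classE (relf _) iacL (basE L)) (calG_classE (relf _) iacM (basE M)).
  have [[aL _] [aM _]] := (iacL, iacM).
  move/group_class_eq/(calG_isog _ _ aL aM (basE L) (basE M)) => LM.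
  exact/alg_class_eq.
pose L := calL p_pr ucsG; have iacL : is_IAC L := calL_IAC p_pr p_odd ucsG.
exists (alg_class L); first by exists L.
rewrite (calG_classE (relf _) iacL (basE L)).
exact/group_class_eq/calG_calL/basE.
Qed.

Lemma calL_class_bijective :
  bijective_between (UCS_p2 p) (IAC_p p) (calL_class p_pr).
Proof.
split=> [_ [gT ucsG ->]|_ _ [gT ucsG ->] [hT ucsH ->]|_ [L iacL ->]].
- by rewrite (calL_classE ucsG); exists (calL p_pr ucsG); first exact: calL_IAC.
- rewrite (calL_classE ucsG) (calL_classE ucsH) => /alg_class_eq/calL_isog gh.
  exact/group_class_eq.
pose H := relfree_model (\dim {:L}) p_pr.
have [ucs Liso] := calL_calG H iacL (vbasisP _).
exists (group_class (calG (vbasis {:L}) H)).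
  by exists (calG (vbasis {:L}) H).
by rewrite (calL_classE ucs); apply/alg_class_eq.
Qed.

End Correspondence.

Theorem theorem3p5 (p : nat) (p_pr : prime p) (p_odd : odd p) :
  [/\ (forall (gT : finGroupType) (G : {group gT}) (ucsG : is_ucs_p2 p G),
         is_IAC (calL p_pr ucsG) /\
         forall (r : nat) (v : r.-tuple (calL p_pr ucsG)) (H : relfree p r),
           basis_of {:calL p_pr ucsG} v -> [set: calG v H] \isog G),
      (forall L : algebra 'F_p, is_IAC L ->
         forall (r : nat) (v : r.-tuple L) (H : relfree p r),
           basis_of {:L} v ->
           exists ucsGL : is_ucs_p2 p [set: calG v H]%G,
             alg_isomorphic (calL p_pr ucsGL) L),
      bijective_between (IAC_p p) (UCS_p2 p) (@calG_class p)
    & bijective_between (UCS_p2 p) (IAC_p p) (calL_class p_pr)].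
Proof.
split.
- move=> gT G ucsG; split; first exact: calL_IAC.
  by move=> r v H; apply: calG_calL.
- by move=> L iacL r v H; apply: calL_calG.
- exact: calG_class_bijective.
exact: calL_class_bijective.
Qed.
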